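(* Let $1<c<4/3$. Then the sequence $(u_n)_{n\geq 1}$ defined by $u_n=\mathbf t\left(\lfloor n^c\rfloor\right)$ is normal; that is, for every integer $T\geq 1$ and every $(\varepsilon_0,\ldots,\varepsilon_{T-1})\in\{0,1\}^T$, \[ \lim_{N\to\infty}\frac1N\left|\left\{1\leq n\leq N:\ u_{n+j}=\varepsilon_j\text{ for all }0\leq j<T\right\}\right|=2^{-T}. \]
   Context: For a nonnegative integer $n$, $s(n)$ denotes the number of $1$'s in the binary representation of $n$ (the binary sum-of-digits function). The Thue--Morse sequence is $\mathbf t(n)=s(n)\bmod 2\in\{0,1\}$. $\lfloor x\rfloor$ denotes the integer part of $x$. *)

(* Defs.v *)
From HB Require Import structures.
From mathcomp Require Import all_boot all_order all_algebra.
From mathcomp Require Import all_classical all_reals all_analysis.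

Set Implicit Arguments.
Unset Strict Implicit.
Unset Printing Implicit Defensive.

Import Order.TTheory GRing.Theory Num.Theory.
Import numFieldNormedType.Exports.

Local Open Scope classical_set_scope.
Local Open Scope ring_scope.

Definition binary_digit (n i : nat) : nat := ((n %/ 2 ^ i) %% 2)%N.

(* Since n < 2 ^ n, all nonzero binary digits of n have position i < n. *)
Definition binary_digit_sum (n : nat) : nat :=
  count (fun i => binary_digit n i == 1%N) (iota 0 n).

Definition thue_morse (n : nat) : nat := (binary_digit_sum n %% 2)%N.

(* The sequence is (u n) for n >= 1; the value u 0 is never used. *)
Definition block_count (u : nat -> nat) (T : nat) (eps : 'I_T -> 'I_2)
    (N : nat) : nat :=
  count (fun n => [forall j : 'I_T, u (n + j)%N == eps j]) (index_iota 1 N.+1).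

Definition binary_normal (R : realType) (u : nat -> nat) : Prop :=
  forall (T : nat), (1 <= T)%N -> forall (eps : 'I_T -> 'I_2),
    (fun N : nat => (block_count u eps N)%:R / N%:R : R) @ \oo
      --> (2 ^- T : R).

(* On nonnegative reals, such as n `^ c, Num.truncn is the floor. *)
Definition thue_morse_power (R : realType) (c : R) (n : nat) : nat :=
  thue_morse (Num.truncn (n%:R `^ c)).

(* Main.v *)
Require Import Defs.
From HB Require Import structures.
From mathcomp Require Import all_boot all_order all_algebra.
From mathcomp Require Import all_classical all_reals all_analysis.
From mathcomp Require Import ring lra zify.

Set Implicit Arguments.
Unset Strict Implicit.
Unset Printing Implicit Defensive.

Import Order.TTheory GRing.Theory Num.Theory.
Import numFieldNormedType.Exports.

Local Open Scope classical_set_scope.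
Local Open Scope ring_scope.

(* For [x n = n^c] one has, over stretches of length [H] comparable to
   [n^(2-c)], a second difference of [x] that is nearly constant and of order
   [1/H], while the first difference [al] is of order [n^(c-1)]; for [c < 4/3],
   [al^2] is much smaller than [H].  Normality reduces to showing that the
   means of all products [f n = prod_(j in J) (-1)^t(floor (x (n + j)))], [J]
   nonempty, vanish.

   By van der Corput's inequality [J] may be replaced by a union of two disjoint
   translates of [J], so [#|J|] is even.  Then adding a multiple of [Q = 2^lam] to
   [x n] does not change the product, apart from rare carries, when [Q] is a
   large multiple of [al].  So along a stretch [f n] is a function of the cell,
   of width [1/P], of [x n mod Q], and it suffices to equidistribute [x n] among
   the [P Q] cells in quadratic mean.  That is a count of pairs [(n, n + k)] in
   nearby cells: for fixed [k] the difference [x (n + k) - x n] increases in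
   nearly constant small steps and winds around the circle [R / Q Z] many times.

   What remains is the average over [m < Q] of [prod_j (-1)^t(m + j d + e_j)]
   with [d = floor al] and [e_j] bounded.  Expanding in base [U = 2^(q+2)], each
   digit of [d] equal to [T + 1] forces two residues of [m] to cancel and
   saves a factor [1 - 2/U]; as [n] varies, the last [W] digits of [d] are
   equidistributed, and on average the total saving is
   [(1 - 2/U^2)^W]. *)

(** * The Thue-Morse sign *)

Lemma binary_digit_small (n i : nat) : (n < 2 ^ i)%N -> binary_digit n i = 0%N.
Proof. by move=> h; rewrite /binary_digit divn_small. Qed.

Lemma binary_digit_sumE (m n : nat) : (n <= m)%N ->
  binary_digit_sum n = count (fun i => binary_digit n i == 1%N) (iota 0 m).
Proof.
move=> nm; rewrite -(subnKC nm) iotaD count_cat /binary_digit_sum.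
rewrite [X in (_ + X)%N](_ : _ = 0%N) ?addn0 //.
apply/eqP; rewrite -leqn0 leqNgt -has_count; apply/hasPn => i.
rewrite mem_iota add0n => /andP[ni _].
by rewrite binary_digit_small // (leq_trans (ltn_expl n (ltnSn 1))) ?leq_exp2l.
Qed.

Lemma binary_digit_sum_split (k a b : nat) : (b < 2 ^ k)%N ->
  binary_digit_sum (2 ^ k * a + b) =
  (binary_digit_sum a + binary_digit_sum b)%N.
Proof.
move=> bk; have k2 : (0 < 2 ^ k)%N by rewrite expn_gt0.
set N := (2 ^ k * a + b)%N.
rewrite (@binary_digit_sumE (k + N)) ?leq_addl // iotaD count_cat addnC.
congr (_ + _)%N.
  rewrite (@binary_digit_sumE N); last by rewrite /N; nia.
  rewrite add0n -{1}[k]addn0 iotaDl count_map; apply: eq_count => i /=.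
  rewrite /binary_digit expnD divnMA /N mulnC divnMDl // (divn_small bk).
  by rewrite addn0.
rewrite (@binary_digit_sumE (k + b)) ?leq_addl // iotaD count_cat.
rewrite [X in (_ + X)%N](_ : _ = 0%N) ?addn0.
  apply: eq_in_count => i; rewrite mem_iota add0n /= => ik.
  rewrite /binary_digit /N -(subnKC ik) addSnnS expnD -mulnA mulnC divnMDl ?expn_gt0 //.
  by rewrite expnS -mulnA mulnC -modnDm modnMl add0n modn_mod.
apply/eqP; rewrite -leqn0 leqNgt -has_count; apply/hasPn => i.
rewrite mem_iota add0n => /andP[ki _].
by rewrite binary_digit_small // (leq_trans bk) ?leq_exp2l.
Qed.

Definition tm_sign (R : pzRingType) (n : nat) : R := (-1) ^+ thue_morse n.

Lemma tm_sign_split (R : pzRingType) (k a b : nat) : (b < 2 ^ k)%N ->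
  tm_sign R (2 ^ k * a + b) = tm_sign R a * tm_sign R b.
Proof.
move=> bk; rewrite /tm_sign /thue_morse binary_digit_sum_split //.
by rewrite !modn2 !signr_odd exprD.
Qed.

Lemma normr_tm_sign (R : numDomainType) (n : nat) : `|tm_sign R n| = 1.
Proof. exact: normr_sign. Qed.

Definition tm_prod (R : pzRingType) (J : seq nat) (f : nat -> nat) : R :=
  \prod_(j <- J) tm_sign R (f j).

Lemma normr_tm_prod (R : numDomainType) (J : seq nat) (f : nat -> nat) :
  `|tm_prod R J f| = 1.
Proof.
by rewrite normr_prod big1_seq // => j _; rewrite normr_tm_sign.
Qed.

Lemma tm_prod_split (R : comPzRingType) (k : nat) (J : seq nat)
    (a b : nat -> nat) : {in J, forall j, (b j < 2 ^ k)%N} ->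
  tm_prod R J (fun j => 2 ^ k * a j + b j)%N = tm_prod R J a * tm_prod R J b.
Proof.
move=> bk; rewrite -big_split /=; apply: eq_big_seq => j jJ.
by rewrite tm_sign_split // bk.
Qed.

Lemma tm_prod_const_even (R : comPzRingType) (J : seq nat) (n : nat) :
  ~~ odd (size J) -> tm_prod R J (fun=> n) = 1.
Proof.
move=> evJ; rewrite /tm_prod big_const_seq count_predT iter_mulr_1.
by rewrite /tm_sign -exprM -signr_odd oddM (negbTE evJ) andbF.
Qed.

(** * Correlations of the Thue-Morse sign *)

Lemma big_nat_addn (V : nmodType) (m n : nat) (F : nat -> V) :
  \sum_(0 <= k < m + n) F k =
  \sum_(0 <= k < m) F k + \sum_(0 <= k < n) F (m + k)%N.
Proof.
rewrite (@big_cat_nat _ _ _ m) ?leq_addr //=; congr (_ + _).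
rewrite -[X in \sum_(X <= _ < _) _]add0n big_addn addKn.
by apply: eq_bigr => k _; rewrite addnC.
Qed.

Lemma big_nat_mul_mod (V : nmodType) (a b : nat) (F : nat -> V) :
  \sum_(0 <= m < a * b) F m =
  \sum_(0 <= r < a) \sum_(0 <= m < b) F (a * m + r)%N.
Proof.
elim: b => [|b IH].
  by rewrite muln0 big_geq // big1 // => r _; rewrite big_geq.
rewrite mulnS addnC big_nat_addn IH -big_split /=.
by apply: eq_bigr => r _; rewrite big_nat_recr.
Qed.

Lemma seq_has_max (J : seq nat) : J != [::] ->
  exists2 j, j \in J & {in J, forall i, (i <= j)%N}.
Proof.
case: J => // a s _; elim: s a => [|b s IH] a.
  by exists a; rewrite ?mem_head // => i; rewrite inE => /eqP ->.
have [j js jmax] := IH b; have [aj|ja] := leqP a j.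
  exists j => [|i]; first by rewrite inE js orbT.
  by rewrite inE => /orP[/eqP ->|/jmax].
exists a => [|i]; first by rewrite mem_head.
by rewrite inE => /orP[/eqP ->//|/jmax ij]; exact: leq_trans ij (ltnW ja).
Qed.

(* At the largest [c = j v + e j] the residue [r = 2^q - c + y 2^q] makes
   [r + c] overflow into the digit block of [y], while the other terms see [y]
   unchanged; since tm 1 = tm 2 but tm 2 <> tm 3, taking y = 1 and y = 2 flips
   the sign of the whole product. *)
Lemma tm_prod_cancelling_residues (R : comPzRingType) (T q : nat) (J : seq nat)
    (e : nat -> nat) : uniq J -> J != [::] -> {in J, forall j, (j < T)%N} ->
  {in J, forall j, (e j <= T)%N} -> (T * T.+1 + T < 2 ^ q)%N ->
  let c j := (j * T.+1 + e j)%N in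
  exists r1 r2 : nat,
   [/\ (r1 < r2)%N, (r2 < 2 ^ q.+2)%N,
       {in J, forall j, (r1 + c j < 2 ^ q.+2)%N},
       {in J, forall j, (r2 + c j < 2 ^ q.+2)%N} &
       tm_prod R J (fun j => r1 + c j)%N = - tm_prod R J (fun j => r2 + c j)%N].
Proof.
move=> uJ nJ JT eT qT c.
have [jm jmJ jmax] := seq_has_max nJ.
have cm j : j \in J -> (c j < c jm)%N || (j == jm).
  move=> jJ; have := jmax j jJ; rewrite leq_eqVlt => /orP[->|jl]; first by rewrite orbT.
  by apply/orP; left; rewrite /c; have := eT j jJ; nia.
have cq : (c jm < 2 ^ q)%N.
  apply: leq_ltn_trans qT; rewrite /c.
  by have := eT _ jmJ; have := JT _ jmJ; nia.
have cle j : j \in J -> (c j <= c jm)%N by move=> /cm/orP[/ltnW//|/eqP ->].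
have e4 : (2 ^ q.+2 = 4 * 2 ^ q)%N by rewrite !expnS mulnA.
pose r y := (2 ^ q * y + (2 ^ q - c jm))%N.
have rmax y : tm_sign R (r y + c jm) = tm_sign R y.+1.
  rewrite -addnA subnK ?(ltnW cq) // -mulnSr -[X in tm_sign _ X]addn0.
  rewrite tm_sign_split ?expn_gt0 // -[RHS]mulr1; congr (_ * _).
have rj y j : j \in J -> j != jm ->
    tm_sign R (r y + c j) = tm_sign R y * tm_sign R (2 ^ q - c jm + c j).
  move=> jJ jnm; rewrite -addnA tm_sign_split //.
  by have := cm j jJ; rewrite (negbTE jnm) orbF; lia.
have t1 : tm_sign R 1 = -1 by [].
have t2 : tm_sign R 2 = -1 by [].
have t3 : tm_sign R 3 = 1 by rewrite /tm_sign (_ : thue_morse 3 = 0%N).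
exists (r 1%N), (r 2%N); split.
- rewrite /r; nia.
- rewrite /r e4; nia.
- by move=> j /cle; rewrite /r e4; nia.
- by move=> j /cle; rewrite /r e4; nia.
rewrite /tm_prod !(bigD1_seq jm) //= !rmax t2 t3 -mulNr; congr (_ * _).
rewrite big_seq_cond [RHS]big_seq_cond; apply: eq_bigr => j /andP[jJ jnm].
by rewrite !rj // t1 t2.
Qed.

Fixpoint digit_weight (R : pzRingType) (U v : nat) (k : R) (W d : nat) : R :=
  if W is W'.+1 then
    (if (d %% U == v)%N then k else 1) * digit_weight U v k W' (d %/ U)%N
  else 1.

Lemma digit_weight_ge0 (R : numDomainType) (U v W d : nat) (k : R) :
  0 <= k -> 0 <= digit_weight U v k W d.
Proof.
by move=> k0; elim: W d => //= W IH d; rewrite mulr_ge0 //; case: ifP.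
Qed.

Lemma digit_weight_mod (R : pzRingType) (U v W d : nat) (k : R) :
  digit_weight U v k W (d %% U ^ W)%N = digit_weight U v k W d.
Proof.
elim: W d => //= W IH d; have [->|U0] := posnP U.
  by rewrite exp0n // modn0.
congr (_ * _); first by rewrite modn_dvdm // expnS dvdn_mulr.
by rewrite -[RHS]IH expnS modn_divl mulnC.
Qed.

Lemma sum_digit_weight (R : comPzRingType) (U v W : nat) (k : R) : (v < U)%N ->
  \sum_(0 <= d < U ^ W) digit_weight U v k W d = (U.-1%:R + k) ^+ W.
Proof.
move=> vU; have U0 : (0 < U)%N by exact: leq_ltn_trans vU.
elim: W => [|W IH]; first by rewrite expn0 big_nat1 expr0.
rewrite expnS big_nat_mul_mod exprS -IH.
have -> : U.-1%:R + k = \sum_(0 <= r < U) (if r == v then k else 1).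
  rewrite big_mkord (bigD1 (Ordinal vU)) //= eqxx addrC; congr (_ + _).
  rewrite (eq_bigr (fun=> 1)) => [|i]; last first.
    by rewrite -val_eqE /= => /negbTE ->.
  by rewrite sumr_const cardC1 card_ord.
rewrite mulr_suml; apply: eq_big_nat => r /andP[_ rU].
rewrite mulr_sumr; apply: eq_bigr => m _.
by rewrite /= mulnC modnMDl divnMDl // modn_small // divn_small // addn0.
Qed.

Lemma tm_correlation_bound (R : realFieldType) (T q : nat) (J : seq nat)
    (W Q d : nat) (e : nat -> nat) : uniq J -> J != [::] ->
  {in J, forall j, (j < T)%N} -> {in J, forall j, (e j <= T)%N} ->
  (T * T.+1 + T < 2 ^ q)%N ->
  `|\sum_(0 <= m < (2 ^ q.+2) ^ W * Q) tm_prod R J (fun j => m + (j * d + e j))%N|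
  <= ((2 ^ q.+2) ^ W * Q)%:R *
     digit_weight (2 ^ q.+2) T.+1 (1 - 2 / (2 ^ q.+2)%:R) W d.
Proof.
move=> uJ nJ JT eT qT; set U := (2 ^ q.+2)%N; set k := (1 - _).
have U0 : (0 < U)%N by rewrite expn_gt0.
have TU : (T <= U)%N.
  have : (2 ^ q <= U)%N by rewrite leq_exp2l // -addn2 leq_addr.
  by have := qT; nia.
elim: W d e eT => [|W IH] d e eT.
  rewrite expn0 mul1n /= mulr1 (le_trans (ler_norm_sum _ _ _)) //.
  under eq_bigr do rewrite normr_tm_prod.
  by rewrite big_mkord sumr_const card_ord.
set v := (d %% U)%N; pose c j := (j * v + e j)%N.
pose S (f : nat -> nat) : R :=
  \sum_(0 <= m < U ^ W * Q) tm_prod R J (fun j => m + (j * (d %/ U) + f j))%N.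
pose t r := tm_prod R J (fun j => (r + c j) %% U)%N.
pose g r j := ((r + c j) %/ U)%N.
have vU : (v < U)%N by rewrite ltn_mod.
have step r m : tm_prod R J (fun j => U * m + r + (j * d + e j))%N =
    t r * tm_prod R J (fun j => m + (j * (d %/ U) + g r j))%N.
  rewrite mulrC -(@tm_prod_split _ q.+2) => [|j _]; last by rewrite ltn_mod.
  apply: eq_bigr => j _; congr (tm_sign _ _).
  rewrite !mulnDr -/U [(U * g r j)%N]mulnC -!addnA -divn_eq.
  rewrite /c /v {1}(divn_eq d U); lia.
set B := (U ^ W * Q)%:R * digit_weight U T.+1 k W (d %/ U).
have SB r : (r < U)%N -> `|S (g r)| <= B.
  move=> rU; apply: IH => j jJ; rewrite /g -ltnS ltn_divLR // /c.
  have := JT j jJ; have := eT j jJ; move: vU rU; clearbody v U; nia.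
rewrite expnS -[(U * U ^ W * Q)%N]mulnA big_nat_mul_mod.
under eq_bigr => r _ do (under eq_bigr => m _ do rewrite step).
under eq_bigr => r _ do rewrite -mulr_sumr -/(S (g r)).
rewrite [digit_weight _ _ _ _ _]/= -/v natrM.
rewrite [X in _ <= X](_ : _ = (U%:R * (if (v == T.+1)%N then k else 1)) * B);
  last by rewrite /B; move: (U ^ W * Q)%N (digit_weight _ _ _ _ _)
    (if _ then _ else _) => ? ? ?; ring.
have tS r : `|t r * S (g r)| = `|S (g r)| by rewrite normrM normr_tm_prod mul1r.
have [vT|_] := eqVneq v T.+1; last first.
  rewrite mulr1 mulr_natl (le_trans (ler_norm_sum _ _ _)) // big_mkord.
  apply: le_trans (_ : \sum_(i < U) B <= _); last by rewrite sumr_const card_ord.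
  by apply: ler_sum => i _; rewrite tS SB.
have [r1 [r2 [r12 r2U c1 c2 opp]]] :=
  @tm_prod_cancelling_residues R T q J e uJ nJ JT eT qT.
have r1U : (r1 < U)%N by exact: ltn_trans r2U.
pose o1 := Ordinal r1U; pose o2 := Ordinal r2U.
have o21 : o2 != o1 by rewrite -val_eqE /= neq_ltn r12 orbT.
rewrite -/U in c1 c2.
have tE r : {in J, forall j, (r + (j * T.+1 + e j) < U)%N} ->
    t r = tm_prod R J (fun j => r + (j * T.+1 + e j))%N.
  move=> rJ; rewrite /t /tm_prod; apply: eq_big_seq => j jJ; rewrite /c vT.
  by rewrite modn_small; first by []; exact: rJ j jJ.
have tt : t r1 = - t r2 by rewrite !tE.
have gg : S (g r1) = S (g r2).
  apply: eq_bigr => m _; apply: eq_big_seq => j jJ; congr (tm_sign _ _).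
  by rewrite /g /c vT (divn_small (c1 j jJ)) (divn_small (c2 j jJ)).
rewrite big_mkord (bigD1 o1) // (bigD1 o2) //= tt gg addrA mulNr addNr add0r.
rewrite (le_trans (ler_norm_sum _ _ _)) //.
apply: le_trans (ler_sum _ (_ : forall i, _ -> _ <= B)) _.
  by move=> i _; rewrite tS SB.
have : \sum_(i < U) B = U%:R * B by rewrite sumr_const card_ord mulr_natl.
rewrite (bigD1 o1) // (bigD1 o2) //= => /eqP; rewrite addrA addrC eq_sym -subr_eq => /eqP <-.
have UR : U%:R != 0 :> R by rewrite pnatr_eq0 -lt0n.
rewrite /k -/U le_eqVlt; apply/orP; left; apply/eqP; field.
exact: UR.
Qed.

(** * Counting in slowly increasing sequences *)

Lemma incr_diff_ge (R : realFieldType) (H : nat) (y : nat -> R) (g : R) :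
  (forall n, (n.+1 < H)%N -> g <= y n.+1 - y n) ->
  forall m k, (m + k < H)%N -> k%:R * g <= y (m + k)%N - y m.
Proof.
move=> yg m; elim=> [|k IH] h; first by rewrite addn0 mul0r subrr.
have := yg (m + k)%N; rewrite -addnS => /(_ h).
have := IH ltac:(lia); rewrite -natr1 mulrDl mul1r; lra.
Qed.

Lemma incr_diff_le (R : realFieldType) (H : nat) (y : nat -> R) (g : R) :
  (forall n, (n.+1 < H)%N -> y n.+1 - y n <= g) ->
  forall m k, (m + k < H)%N -> y (m + k)%N - y m <= k%:R * g.
Proof.
move=> yg m; elim=> [|k IH] h; first by rewrite addn0 mul0r subrr.
have := yg (m + k)%N; rewrite -addnS => /(_ h).
have := IH ltac:(lia); rewrite -natr1 mulrDl mul1r; lra.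
Qed.

Lemma count_separated (R : realFieldType) (H : nat) (y : nat -> R) (g a w : R) :
  0 < g -> 0 <= w -> (forall n, (n.+1 < H)%N -> g <= y n.+1 - y n) ->
  \sum_(0 <= n < H) (a <= y n < a + w)%R%:R <= w / g + 1.
Proof.
move=> g0 w0 yg.
have claim h : (h <= H)%N ->
    \sum_(0 <= n < h) (a <= y n < a + w)%R%:R = 0 :> R \/
    exists m, [/\ (m < h)%N, a <= y m < a + w &
      g * (\sum_(0 <= n < h) (a <= y n < a + w)%R%:R - 1) <= y m - a].
  elim: h => [|h IH] hH; first by left; rewrite big_geq.
  rewrite big_nat_recr //=.
  case wh : (a <= y h < a + w); last first.
    rewrite addr0; case: (IH (ltnW hH)) => [|[m [mh my ms]]]; first by left.
    by right; exists m; split=> //; exact: ltnW.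
  right; exists h; split=> //.
  case: (IH (ltnW hH)) => [->|[m [mh my ms]]].
    by rewrite add0r subrr mulr0 subr_ge0; case/andP: wh.
  rewrite addrK.
  have := incr_diff_ge yg (m := m) (k := h - m); rewrite subnKC ?(ltnW mh) //.
  move=> /(_ hH); have : 1 <= (h - m)%:R :> R by rewrite ler1n subn_gt0.
  move: ms; rewrite mulrBr mulr1 => ms k1 yk.
  have : g <= (h - m)%:R * g by rewrite ler_peMl // ltW.
  lra.
case: (claim H (leqnn H)) => [->|[m [mH /andP[_ my] ms]]].
  by rewrite addr_ge0 ?divr_ge0 // ltW.
rewrite -lerBlDr ler_pdivlMr // mulrC; apply: le_trans ms _; lra.
Qed.

Lemma count_separated_mod (R : archiRealFieldType) (H : nat) (y : nat -> R)
    (b : nat -> bool) (g g' a w D : R) :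
  0 < g -> 0 <= g' -> 0 < D -> 0 <= w <= D ->
  (forall n, (n.+1 < H)%N -> g <= y n.+1 - y n <= g') ->
  (forall n, (n < H)%N -> b n -> exists z : int,
     a + z%:~R * D <= y n < a + z%:~R * D + w) ->
  \sum_(0 <= n < H) (b n)%:R <= (H%:R * g' / D + 2) * (w / g + 1).
Proof.
move=> g0 g'0 D0 /andP[w0 wD] yg by_.
have [->|H0] := posnP H.
  rewrite big_geq // mul0r mul0r add0r mulr_ge0 // addr_ge0 // divr_ge0 //.
  exact: ltW.
have yg1 n : (n.+1 < H)%N -> g <= y n.+1 - y n by move/yg/andP => [].
have yg2 n : (n.+1 < H)%N -> y n.+1 - y n <= g' by move/yg/andP => [].
pose z0 := Num.floor ((y 0%N - a - w) / D).
pose Z := (Num.truncn (H%:R * g' / D + 1)).+1.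
pose aa i := a + (z0 + 1 + i%:Z)%:~R * D.
have Z2 : Z%:R <= H%:R * g' / D + 2.
  rewrite /Z -natr1.
  have := @Num.Theory.truncn_le R (H%:R * g' / D + 1).
  have : 0 <= H%:R * g' / D + 1 by rewrite addr_ge0 // divr_ge0 ?mulr_ge0 // ltW.
  by move=> -> /esym h; lra.
have step n : (n < H)%N ->
    (b n)%:R <= \sum_(0 <= i < Z) (aa i <= y n < aa i + w)%R%:R.
  move=> nH; case: (boolP (b n)) => [bn|_]; last exact: sumr_ge0.
  have [z /andP[z1 z2]] := by_ n nH bn.
  have y0n : y 0%N <= y n.
    have := incr_diff_ge yg1 (m := 0%N) (k := n); rewrite add0n => /(_ nH).
    have : 0 <= n%:R * g by rewrite mulr_ge0 // ltW.
    lra.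
  have yn0 : y n <= y 0%N + H%:R * g'.
    have := incr_diff_le yg2 (m := 0%N) (k := n); rewrite add0n => /(_ nH).
    have : n%:R * g' <= H%:R * g' by rewrite ler_wpM2r // ler_nat ltnW.
    lra.
  have zz0 : z0 + 1 <= z.
    rewrite -ltzD1 ltrD2r -(ltr_int R).
    apply: le_lt_trans (Num.Theory.floor_le _) _.
    rewrite ltr_pdivrMr //; lra.
  pose i := `|(z - (z0 + 1))%R|%N.
  have zi : z = z0 + 1 + i%:Z by rewrite /i gez0_abs ?subr_ge0 //; ring.
  have iZ : (i < Z)%N.
    rewrite /Z ltnS truncn_ge_nat; last by rewrite addr_ge0 // divr_ge0 ?mulr_ge0 // ltW.
    have := floorD1_gt ((y 0%N - a - w) / D); rewrite -/z0 => fl.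
    have : i%:R * D <= (H%:R * g' / D + 1) * D; last by rewrite ler_pM2r.
    rewrite mulrDl mul1r divfK ?gt_eqF //.
    move: fl; rewrite ltr_pdivrMr // => fl.
    move: z1; rewrite zi rmorphD mulrDl /= -pmulrn; lra.
  rewrite big_mkord (bigD1 (Ordinal iZ)) //= /aa -zi z1 z2 /=.
  by rewrite lerDl sumr_ge0.
apply: le_trans (_ : \sum_(0 <= n < H) \sum_(0 <= i < Z)
   (aa i <= y n < aa i + w)%R%:R <= _).
  by rewrite big_nat [leRHS]big_nat; apply: ler_sum => n /andP[_ nH]; exact: step.
rewrite exchange_big /=.
apply: le_trans (ler_sum _ (fun i _ => count_separated (aa i) g0 w0 yg1)) _.
rewrite big_mkord sumr_const card_ord -[leLHS]mulr_natl ler_wpM2r //.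
by rewrite addr_ge0 // divr_ge0 // ltW.
Qed.

Definition diff2 (R : pzRingType) (x : nat -> R) (n : nat) : R :=
  (x n.+2 - x n.+1) - (x n.+1 - x n).

Lemma diff_shift_incr (R : realFieldType) (H : nat) (x : nat -> R) (g g' : R) :
  (forall n, (n < H)%N -> g <= diff2 x n <= g') ->
  forall k n, (n + k < H)%N ->
  k%:R * g <= (x (n.+1 + k)%N - x n.+1) - (x (n + k)%N - x n) <= k%:R * g'.
Proof.
move=> d2 k n nkH; pose y i := x i.+1 - x i.
have y1 i : (i.+1 < H)%N -> g <= y i.+1 - y i.
  by move=> iH; have /andP[] := d2 i ltac:(lia).
have y2 i : (i.+1 < H)%N -> y i.+1 - y i <= g'.
  by move=> iH; have /andP[] := d2 i ltac:(lia).
have := incr_diff_ge y1 nkH; have := incr_diff_le y2 nkH.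
rewrite /y addSn => h1 h2; apply/andP; split; lra.
Qed.

Lemma sum_sym_pairs (R : comPzRingType) (H : nat) (A : nat -> nat -> R) :
  (forall n m, A n m = A m n) ->
  \sum_(0 <= n < H) \sum_(0 <= m < H) A n m =
  \sum_(0 <= n < H) A n n +
  2 * \sum_(1 <= k < H) \sum_(0 <= n < H - k) A n (n + k)%N.
Proof.
move=> sA; elim: H => [|H IH]; first by rewrite !big_geq // mulr0 addr0.
rewrite big_nat_recr //=.
under eq_bigr do rewrite big_nat_recr //=.
rewrite big_split /= IH [X in _ + X]big_nat_recr //= [X in _ = X + _]big_nat_recr //=.
have -> : \sum_(1 <= k < H.+1) \sum_(0 <= n < H.+1 - k) A n (n + k)%N =
   \sum_(1 <= k < H) \sum_(0 <= n < H - k) A n (n + k)%N +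
   \sum_(0 <= n < H) A n H.
  have -> : \sum_(1 <= k < H) \sum_(0 <= n < H - k) A n (n + k)%N =
    \sum_(1 <= k < H.+1) \sum_(0 <= n < H - k) A n (n + k)%N.
    case: H {IH} => [|H]; first by rewrite !big_geq.
    by rewrite [RHS]big_nat_recr //= subnn [X in _ = _ + X]big_geq // addr0.
  have -> : \sum_(0 <= n < H) A n H = \sum_(1 <= k < H.+1) A (H - k)%N H.
    rewrite big_add1 /= big_nat_rev /=; apply: eq_big_nat => n nH.
    by congr (A _ H); lia.
  rewrite -big_split /=; apply: eq_big_nat => k /andP[k1 kH].
  by rewrite subSn // big_nat_recr //= subnK.
have -> : \sum_(0 <= i < H) A H i = \sum_(0 <= n < H) A n H.
  by apply: eq_bigr => i _; exact: sA.
ring.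
Qed.

Definition cyc_diff (M a b : nat) : nat := ((b + (M - a %% M)) %% M)%N.

Definition cyc_near (M t a b : nat) : bool :=
  (cyc_diff M a b <= t)%N || (M <= cyc_diff M a b + t)%N.

Lemma cyc_diffE (M a b : nat) : (0 < M)%N ->
  exists z : int, (b%:Z - a%:Z = (cyc_diff M a b)%:Z + z * M%:Z)%R.
Proof.
move=> M0; rewrite /cyc_diff; set S := (b + _)%N.
exists ((S %/ M)%:Z - 1 - (a %/ M)%:Z).
have h1 := divn_eq S M; have h2 := divn_eq a M; have h3 := ltn_pmod a M0.
rewrite {1}h2; have : (S + a %% M = b + M)%N by rewrite /S; lia.
nia.
Qed.

Lemma cyc_near_sym (M t a b : nat) : (0 < M)%N ->
  cyc_near M t a b = cyc_near M t b a.
Proof.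
move=> M0.
wlog suff h : a b / cyc_near M t a b -> cyc_near M t b a.
  by apply/idP/idP; exact: h.
have [z hz] := cyc_diffE a b M0; have [z' hz'] := cyc_diffE b a M0.
have l1 : (cyc_diff M a b < M)%N by rewrite ltn_pmod.
have l2 : (cyc_diff M b a < M)%N by rewrite ltn_pmod.
have e : ((cyc_diff M a b)%:Z + (cyc_diff M b a)%:Z = - (z + z') * M%:Z)%R.
  by move: hz hz'; lia.
rewrite /cyc_near.
have [z0|z0] : (- (z + z') = 0 \/ - (z + z') = 1)%R.
  have : (- (z + z') < 2)%R by nia.
  have : (- (z + z') > -1)%R by nia.
  lia.
- by move: e; rewrite z0 mul0r; lia.
- by move: e; rewrite z0 mul1r; lia.
Qed.

Lemma cyc_near_truncn (R : archiRealFieldType) (M t : nat) (u v : R) :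
  (0 < M)%N -> 0 <= u -> 0 <= v -> cyc_near M t (Num.truncn u) (Num.truncn v) ->
  exists z : int, - t.+1%:R + z%:~R * M%:R <= v - u <
                  - t.+1%:R + z%:~R * M%:R + 2 * t.+1%:R.
Proof.
move=> M0 u0 v0; set a := Num.truncn u; set b := Num.truncn v => near.
have [e [z [hz e1 e2]]] : exists e z : int,
   [/\ b%:Z - a%:Z = e + z * M%:Z, - t%:Z <= e & e <= t%:Z]%R.
  have [z hz] := cyc_diffE a b M0.
  have l1 : (cyc_diff M a b < M)%N by rewrite ltn_pmod.
  case/orP: near => h; [exists (cyc_diff M a b)%:Z, z |
   exists ((cyc_diff M a b)%:Z - M%:Z), (z + 1)];
   split; lia.
exists z.
have /andP[ua ua'] := truncn_itv u0; have /andP[vb vb'] := truncn_itv v0.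
rewrite -/a -/b in ua ua' vb vb'.
have : (b%:Z - a%:Z)%:~R = (e + z * M%:Z)%:~R :> R by rewrite hz.
rewrite rmorphB rmorphD rmorphM /= -!pmulrn => E.
have E1 : - t%:R <= e%:~R :> R by move: e1; rewrite -(ler_int R) rmorphN /= -pmulrn.
have E2 : e%:~R <= t%:R :> R by move: e2; rewrite -(ler_int R) /= -pmulrn.
move: ua' vb' E1 E2; rewrite -!natr1 => *.
apply/andP; split; lra.
Qed.

Lemma sum_rev_arith_le (R : realFieldType) (H : nat) :
  \sum_(1 <= k < H) (H - k)%:R <= H%:R ^+ 2 / 2 :> R.
Proof.
have : \sum_(1 <= k < H) (H - k)%:R = H%:R * (H%:R - 1) / 2 :> R.
  elim: H => [|H IH]; first by rewrite big_geq // !mul0r.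
  case: H IH => [|H] IH; first by rewrite big_geq // subrr mulr0 mul0r.
  rewrite big_ltn // big_add1 /= subn1 /=.
  rewrite (eq_bigr (fun k => (H.+1 - k)%:R)) => [|k _]; last by rewrite subSS.
  by rewrite IH -!natr1; field.
move=> ->; have : 0 <= H%:R :> R by []; nra.
Qed.

Lemma sum_ltn_minn (R : pzSemiRingType) (H K : nat) :
  \sum_(0 <= k < H) (k < K)%N%:R = (minn H K)%:R :> R.
Proof.
elim: H => [|h IH]; first by rewrite big_geq // min0n.
by rewrite big_nat_recr //= IH -natrD; congr (_%:R); lia.
Qed.

(* Differences [n' - n = k] below [K] are counted trivially; for the others
   [X (n + k) - X n] runs through many periods [M] in small steps. *)
Lemma cyc_near_pairs (R : archiRealFieldType) (H M K t : nat) (X : nat -> R)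
    (g e : R) : (0 < M)%N -> (0 < K)%N -> (2 * t.+1 <= M)%N ->
  0 < g -> 0 <= e <= 1 -> (forall n, 0 <= X n) ->
  (forall n, (n < H)%N -> g <= diff2 X n <= g * (1 + e)) ->
  H%:R * g <= 2 * e -> 2 * K%:R <= e * H%:R / M%:R ->
  4 * M%:R <= e * H%:R * g * K%:R ->
  \sum_(0 <= n < H) \sum_(0 <= m < H)
    (cyc_near M t (Num.truncn (X n)) (Num.truncn (X m)))%:R
  <= (1 + 6 * e) * (2 * t.+1%:R) * H%:R ^+ 2 / M%:R.
Proof.
move=> M0 K0 tM g0 /andP[e0 e1] X0 X2 Hg KH MK.
pose w : R := 2 * t.+1%:R.
have w2 : 2 <= w by rewrite /w -[leLHS]mulr1 ler_wpM2l // ler1n.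
have MR : 0 < M%:R :> R by rewrite ltr0n.
have KR : 0 < K%:R :> R by rewrite ltr0n.
have HR : 0 <= H%:R :> R by [].
have Kg : 0 < K%:R * g by rewrite mulr_gt0.
pose B : R := (1 + e) * w.
pose N k : R := \sum_(0 <= n < H - k)
  (cyc_near M t (Num.truncn (X n)) (Num.truncn (X (n + k)%N)))%:R.
have Nlarge k : (K <= k < H)%N ->
    N k <= B * (1 + e) / M%:R * (H - k)%:R + B * (2 / (K%:R * g)).
  move=> /andP[Kk kH].
  have kR : K%:R <= k%:R :> R by rewrite ler_nat.
  have kg : 0 < k%:R * g by rewrite mulr_gt0 // (lt_le_trans KR).
  have c := @count_separated_mod R (H - k) (fun n => X (n + k)%N - X n)
    (fun n => cyc_near M t (Num.truncn (X n)) (Num.truncn (X (n + k)%N)))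
    (k%:R * g) (k%:R * (g * (1 + e))) (- t.+1%:R) w M%:R kg.
  apply: le_trans (c _ MR _ _ _) _.
  - by rewrite !mulr_ge0 // ltW //; lra.
  - by rewrite /w -natrM ler_nat tM ler0n.
  - move=> n nHk; have nkH : (n + k < H)%N by rewrite addnC -ltn_subRL ltnW.
    exact: (diff_shift_incr X2 nkH).
  - by move=> n nHk; apply: cyc_near_truncn.
  have h1 : w / (k%:R * g) + 1 <= B / (k%:R * g).
    rewrite ler_pdivlMr // mulrDl mul1r divfK ?gt_eqF // /B.
    have : k%:R * g <= H%:R * g by apply: ler_wpM2r; [exact: ltW|rewrite ler_nat ltnW].
    nra.
  have h0 : 0 <= (H - k)%:R * (k%:R * (g * (1 + e))) / M%:R + 2.
    rewrite addr_ge0 // divr_ge0 // !mulr_ge0 // ?(ltW g0) //; lra.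
  apply: le_trans (ler_wpM2l h0 h1) _.
  have -> : ((H - k)%:R * (k%:R * (g * (1 + e))) / M%:R + 2) * (B / (k%:R * g)) =
     B * (1 + e) / M%:R * (H - k)%:R + B * (2 / (k%:R * g)).
    have kn : k%:R != 0 :> R by rewrite gt_eqF // (lt_le_trans KR).
    by field; rewrite kn !gt_eqF.
  rewrite lerD2l ler_wpM2l //; first by rewrite /B; nra.
  by rewrite ler_wpM2l // lef_pV2 ?posrE // ler_wpM2r // ltW.
have Ntriv k : N k <= H%:R.
  apply: le_trans (_ : \sum_(0 <= n < H - k) (1 : R) <= _).
    by apply: ler_sum => n _; case: cyc_near.
  by rewrite big_mkord sumr_const card_ord ler_nat leq_subr.
rewrite sum_sym_pairs; last by move=> n m; rewrite cyc_near_sym.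
have Nle k : (1 <= k < H)%N -> N k <= (k < K)%N%:R * H%:R +
    (B * (1 + e) / M%:R * (H - k)%:R + B * (2 / (K%:R * g))).
  move=> /andP[k1 kH]; have B0 : 0 <= B by rewrite /B; nra.
  have := divr_ge0 (mulr_ge0 B0 (addr_ge0 ler01 e0)) (ltW MR).
  have b2 : 0 <= B * (2 / (K%:R * g)) by rewrite mulr_ge0 // divr_ge0 // ltW.
  have [kK|kK] := ltnP k K => b1.
    by rewrite mul1r; apply: le_trans (Ntriv k) _; rewrite lerDl addr_ge0 // mulr_ge0.
  by rewrite mul0r add0r; apply: Nlarge; rewrite kK.
have cntK : \sum_(1 <= k < H) (k < K)%N%:R <= K%:R :> R.
  apply: le_trans (_ : \sum_(0 <= k < H) (k < K)%N%:R <= _).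
    by case: (H) => [|h]; [rewrite !big_geq|rewrite [leRHS]big_ltn // lerDr].
  by rewrite sum_ltn_minn ler_nat geq_minr.
have diag : \sum_(0 <= n < H)
    (cyc_near M t (Num.truncn (X n)) (Num.truncn (X n)))%:R <= H%:R :> R.
  apply: le_trans (_ : \sum_(0 <= n < H) (1 : R) <= _).
    by apply: ler_sum => n _; case: cyc_near.
  by rewrite big_mkord sumr_const card_ord.
have offd : \sum_(1 <= k < H) N k <=
    K%:R * H%:R + (B * (1 + e) / M%:R * (H%:R ^+ 2 / 2) + H%:R * (B * (2 / (K%:R * g)))).
  apply: le_trans (_ : \sum_(1 <= k < H) ((k < K)%N%:R * H%:R +
    (B * (1 + e) / M%:R * (H - k)%:R + B * (2 / (K%:R * g)))) <= _).
    by rewrite big_nat [leRHS]big_nat; apply: ler_sum => k; exact: Nle.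
  have B0 : 0 <= B by rewrite /B; nra.
  rewrite !big_split /= -mulr_suml -mulr_sumr lerD ?ler_wpM2r // lerD //.
    by rewrite ler_wpM2l ?sum_rev_arith_le // divr_ge0 // ?mulr_ge0 ?addr_ge0 // ltW.
  rewrite sumr_const_nat -[leLHS]mulr_natl ler_wpM2r ?ler_nat ?leq_subr //.
  by rewrite mulr_ge0 // divr_ge0 // ltW.
apply: le_trans (lerD diag (ler_wpM2l _ offd)) _ => //.
pose q : R := H%:R ^+ 2 / M%:R.
have q0 : 0 <= q by rewrite divr_ge0 ?exprn_ge0 // ltW.
have KHq : 2 * (K%:R * H%:R) <= e * q.
  have := ler_wpM2r HR KH; rewrite /q expr2; lra.
have K1 : H%:R <= K%:R * H%:R :> R by rewrite ler_peMl // ler1n.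
have Kq : H%:R * (4 / (K%:R * g)) <= e * q.
  have -> : e * q = H%:R * (e * H%:R / M%:R) by rewrite /q expr2; ring.
  rewrite ler_wpM2l // ler_pdivrMr // mulrAC ler_pdivlMr //; lra.
have -> : (1 + 6 * e) * (2 * t.+1%:R) * H%:R ^+ 2 / M%:R = (1 + 6 * e) * (w * q).
  by rewrite /w /q; ring.
have -> : B * (1 + e) / M%:R * (H%:R ^+ 2 / 2) = (1 + e) ^+ 2 * (w * q) / 2.
  by rewrite /B /q; ring.
have wq : 2 * q <= w * q by rewrite ler_wpM2r.
have {}Kq : H%:R * (B * (2 / (K%:R * g))) <= (1 + e) * e * (w * q) / 2.
  have := ler_wpM2l (_ : 0 <= B / 2) Kq; rewrite /B => /(_ ltac:(nra)); lra.
have eq1 : 2 * (e * q) <= e * (w * q) by have := ler_wpM2l e0 wq; lra.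
have ee : e ^+ 2 * (w * q) <= e * (w * q).
  by rewrite ler_wpM2r; [|lra|rewrite expr2; nra].
have wq0 : 0 <= e * (w * q) by nra.
lra.
Qed.

(** * Equidistribution in cells *)

Definition in_window (M L i a : nat) : bool := (cyc_diff M i a < L)%N.

Lemma cyc_diffK (M a i : nat) : (i < M)%N -> cyc_diff M (cyc_diff M i a) a = i.
Proof.
move=> iM; have M0 : (0 < M)%N by exact: leq_ltn_trans iM.
have [z hz] := cyc_diffE i a M0.
have [z' hz'] := cyc_diffE (cyc_diff M i a) a M0.
have l1 : (cyc_diff M (cyc_diff M i a) a < M)%N by rewrite ltn_pmod.
have : ((cyc_diff M (cyc_diff M i a) a)%:Z - i%:Z = (z - z') * M%:Z)%R by lia.
have [->|zz] := eqVneq (z - z') 0; first by lia.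
have [h|h] : (z - z' <= -1 \/ 1 <= z - z')%R by lia.
- by nia.
- by nia.
Qed.

Lemma sum_cyc_diff (R : pzSemiRingType) (M a : nat) (h g : nat -> R) :
  \sum_(0 <= i < M) h (cyc_diff M i a) * g i =
  \sum_(0 <= l < M) h l * g (cyc_diff M l a).
Proof.
case: M => [|M]; first by rewrite !big_geq.
rewrite !big_mkord.
pose f (i : 'I_M.+1) : 'I_M.+1 := Ordinal (ltn_pmod (a + (M.+1 - i %% M.+1)) (ltn0Sn M)).
have fK : involutive f.
  by move=> i; apply: val_inj; exact: (cyc_diffK a (ltn_ord i)).
rewrite (reindex_inj (inv_inj fK)); apply: eq_bigr => i _.
by rewrite /= -/(cyc_diff M.+1 i a) cyc_diffK.
Qed.

Lemma sum_lt (R : pzSemiRingType) (L M : nat) (g : nat -> R) : (L <= M)%N ->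
  \sum_(0 <= l < M) (l < L)%N%:R * g l = \sum_(0 <= l < L) g l.
Proof.
move=> LM; rewrite (@big_cat_nat _ _ _ L) //= [X in _ + X]big_nat.
rewrite [X in _ + X]big1 ?addr0 => [|l /andP[Ll _]]; last first.
  by rewrite ltnNge Ll mul0r.
by apply: eq_big_nat => l /andP[_ ->]; rewrite mul1r.
Qed.

Lemma sum_in_window (R : pzSemiRingType) (M L a : nat) (g : nat -> R) :
  (L <= M)%N ->
  \sum_(0 <= i < M) (in_window M L i a)%:R * g i =
  \sum_(0 <= l < L) g (cyc_diff M l a).
Proof.
move=> LM; rewrite (sum_cyc_diff M a (fun d => (d < L)%N%:R) g).
exact: (sum_lt (fun l => g (cyc_diff M l a))).
Qed.

(* If [b - a = e] mod [M], then [L - |e|] windows contain both [a] and [b], and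
   [L - |e|] is the number of [t < L] with [|e| <= t]. *)
Lemma sum_in_window_pair (R : numDomainType) (M L a b : nat) :
  (0 < M)%N -> (2 * L <= M)%N ->
  \sum_(0 <= i < M) (in_window M L i a)%:R * (in_window M L i b)%:R
  <= \sum_(0 <= t < L) (cyc_near M t a b)%:R :> R.
Proof.
move=> M0 LM; rewrite sum_in_window; last by lia.
set D := cyc_diff M a b; have DM : (D < M)%N by rewrite ltn_pmod.
have E l : (l < L)%N -> cyc_diff M (cyc_diff M l a) b = ((D + l) %% M)%N.
  move=> lL.
  have [z hz] := cyc_diffE l a M0; have [z' hz'] := cyc_diffE (cyc_diff M l a) b M0.
  have [z2 hz2] := cyc_diffE a b M0; rewrite -/D in hz2.
  have l1 : (cyc_diff M (cyc_diff M l a) b < M)%N by rewrite ltn_pmod.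
  have := divn_eq (D + l) M; have := ltn_pmod (D + l) M0.
  set r := ((D + l) %% M)%N; set k := ((D + l) %/ M)%N => rM Dl.
  have : ((cyc_diff M (cyc_diff M l a) b)%:Z - r%:Z = (z2 + z + k%:Z - z') * M%:Z)%R by lia.
  set y := (_ - z')%R; have [->|yy] := eqVneq y 0; first by lia.
  have [h|h] : (y <= -1 \/ 1 <= y)%R by lia.
  - by nia.
  - by nia.
have [DL|LD] := ltnP D L.
  rewrite big_nat_rev /= big_nat [leRHS]big_nat; apply: ler_sum => l /andP[_ lL].
  rewrite /in_window add0n E; last by lia.
  rewrite /cyc_near -/D modn_small; last by lia.
  by rewrite ler_nat; case: ltnP => // h; case: leqP => //=; lia.
rewrite big_nat [leRHS]big_nat; apply: ler_sum => l /andP[_ lL].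
rewrite /in_window E // /cyc_near -/D ler_nat.
case: (leqP M (D + l)) => h; first by rewrite orbT; case: (_ < _)%N.
by rewrite modn_small // ltnNge (leq_trans LD) ?leq_addr.
Qed.

Lemma sqr_sum_norm_le (R : realFieldType) (M : nat) (f : nat -> R) :
  (\sum_(0 <= i < M) `|f i|) ^+ 2 <= M%:R * \sum_(0 <= i < M) f i ^+ 2.
Proof.
have [->|M0] := posnP M; first by rewrite !big_geq // mulr0 expr0n.
set S := \sum_(0 <= i < M) `|f i|; have MR : 0 < M%:R :> R by rewrite ltr0n.
have : 0 <= \sum_(0 <= i < M) (`|f i| - S / M%:R) ^+ 2.
  by apply: sumr_ge0 => i _; exact: sqr_ge0.
have -> : \sum_(0 <= i < M) (`|f i| - S / M%:R) ^+ 2 =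
    \sum_(0 <= i < M) f i ^+ 2 - S ^+ 2 / M%:R.
  transitivity (\sum_(0 <= i < M) (f i ^+ 2 - 2 * (S / M%:R) * `|f i| + (S / M%:R) ^+ 2)).
    by apply: eq_bigr => i _; rewrite sqrrB real_normK ?num_real //; ring.
  rewrite !big_split /= sumrN -mulr_sumr -/S sumr_const_nat subn0 -[_ *+ M]mulr_natl.
  by field; rewrite gt_eqF.
by rewrite subr_ge0 ler_pdivrMr // mulrC.
Qed.

Lemma window_equidistribution (R : archiRealFieldType) (H M K L : nat)
    (X : nat -> R) (g e theta : R) (G : nat -> R) :
  (0 < M)%N -> (0 < K)%N -> (0 < L)%N -> (2 * L <= M)%N ->
  0 < g -> 0 <= e <= 1 -> (forall n, 0 <= X n) ->
  (forall n, (n < H)%N -> g <= diff2 X n <= g * (1 + e)) ->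
  H%:R * g <= 2 * e -> 2 * K%:R <= e * H%:R / M%:R ->
  4 * M%:R <= e * H%:R * g * K%:R ->
  0 <= theta -> L%:R^-1 + 12 * e <= theta ^+ 2 ->
  (forall i, `|G i| <= 1) ->
  `|\sum_(0 <= n < H) \sum_(0 <= i < M)
      (in_window M L i (Num.truncn (X n)))%:R * G i
    - L%:R * H%:R / M%:R * \sum_(0 <= i < M) G i| <= L%:R * H%:R * theta.
Proof.
move=> M0 K0 L0 LM g0 e01 X0 X2 Hg KH MK th0 thL G1; have /andP[e0 e1] := e01.
have LM' : (L <= M)%N by rewrite (leq_trans _ LM) // leq_pmull.
have MR : 0 < M%:R :> R by rewrite ltr0n.
have LR : 0 < L%:R :> R by rewrite ltr0n.
have L1 : 1 <= L%:R :> R by rewrite ler1n.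
pose W i n : R := (in_window M L i (Num.truncn (X n)))%:R.
pose N i := \sum_(0 <= n < H) W i n.
pose mu : R := L%:R * H%:R / M%:R.
have sN : \sum_(0 <= i < M) N i = L%:R * H%:R.
  rewrite exchange_big /= (eq_bigr (fun=> L%:R)) => [|n _].
    by rewrite sumr_const_nat subn0 -[LHS]mulr_natr.
  rewrite (eq_bigr (fun i => W i n * 1)) => [|i _]; last by rewrite mulr1.
  rewrite sum_in_window //.
  by rewrite sumr_const_nat subn0.
have sN2 : \sum_(0 <= i < M) N i ^+ 2 <=
    (1 + 6 * e) * L%:R * (L%:R + 1) * H%:R ^+ 2 / M%:R.
  have -> : \sum_(0 <= i < M) N i ^+ 2 =
      \sum_(0 <= n < H) \sum_(0 <= m < H) \sum_(0 <= i < M) W i n * W i m.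
    under [RHS]eq_bigr do rewrite exchange_big.
    rewrite [RHS]exchange_big /=; apply: eq_bigr => i _.
    rewrite expr2 /N mulr_suml; apply: eq_bigr => n _.
    by rewrite mulr_sumr.
  apply: le_trans (_ : \sum_(0 <= n < H) \sum_(0 <= m < H) \sum_(0 <= t < L)
      (cyc_near M t (Num.truncn (X n)) (Num.truncn (X m)))%:R <= _).
    by apply: ler_sum => n _; apply: ler_sum => m _; exact: sum_in_window_pair.
  under eq_bigr do rewrite exchange_big.
  rewrite exchange_big /=.
  apply: le_trans (_ : \sum_(0 <= t < L)
     (1 + 6 * e) * (2 * t.+1%:R) * H%:R ^+ 2 / M%:R <= _).
    rewrite big_nat [leRHS]big_nat; apply: ler_sum => t /andP[_ tL].
    by apply: (@cyc_near_pairs _ _ _ K _ _ g) => //; rewrite (leq_trans _ LM) // leq_mul2l.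
  rewrite -!mulr_suml -mulr_sumr -mulr_sumr.
  have -> : 2 * \sum_(0 <= t < L) t.+1%:R = L%:R * (L%:R + 1) :> R.
    elim: (L) => [|l IH]; first by rewrite big_geq // mulr0 mul0r.
    by rewrite big_nat_recr //= mulrDr IH -!natr1; ring.
  by rewrite !mulrA.
have var : \sum_(0 <= i < M) (N i - mu) ^+ 2 <= (L%:R * H%:R * theta) ^+ 2 / M%:R.
  have -> : \sum_(0 <= i < M) (N i - mu) ^+ 2 =
      \sum_(0 <= i < M) N i ^+ 2 - (L%:R * H%:R) ^+ 2 / M%:R.
    transitivity (\sum_(0 <= i < M) (N i ^+ 2 - 2 * mu * N i + mu ^+ 2)).
      by apply: eq_bigr => i _; ring.
    rewrite !big_split /= sumrN -mulr_sumr sN sumr_const_nat subn0.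
    by rewrite -[_ *+ M]mulr_natl /mu; field; rewrite gt_eqF.
  rewrite lerBlDr (le_trans sN2) // -mulrDl ler_pM2r ?invr_gt0 //.
  have h1 : L%:R ^+ 2 * (L%:R^-1 + 12 * e) <= L%:R ^+ 2 * theta ^+ 2.
    by rewrite ler_wpM2l // exprn_ge0 // ltW.
  have h2 : L%:R ^+ 2 * (L%:R^-1 + 12 * e) = L%:R + 12 * e * L%:R ^+ 2 :> R.
    by field; rewrite gt_eqF.
  have h3 : (1 + 6 * e) * L%:R * (L%:R + 1) <= L%:R ^+ 2 * theta ^+ 2 + L%:R ^+ 2.
    have : e * L%:R <= e * L%:R ^+ 2 by rewrite ler_wpM2l // expr2; nra.
    lra.
  rewrite [leRHS](_ : _ = (L%:R ^+ 2 * theta ^+ 2 + L%:R ^+ 2) * H%:R ^+ 2); last by ring.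
  by rewrite ler_wpM2r // exprn_ge0.
have cs := sqr_sum_norm_le M (fun i => N i - mu).
have dev : \sum_(0 <= i < M) `|N i - mu| <= L%:R * H%:R * theta.
  rewrite -(@ler_pXn2r _ 2) ?nnegrE //; last 2 first.
  - by apply: sumr_ge0.
  - by rewrite !mulr_ge0 // ltW.
  apply: le_trans cs _; apply: le_trans (ler_wpM2l (ltW MR) var) _.
  by rewrite mulrCA divff ?gt_eqF // mulr1.
have -> : \sum_(0 <= n < H) \sum_(0 <= i < M) (in_window M L i (Num.truncn (X n)))%:R * G i
    - L%:R * H%:R / M%:R * \sum_(0 <= i < M) G i = \sum_(0 <= i < M) (N i - mu) * G i.
  rewrite exchange_big /= mulr_sumr -sumrB; apply: eq_bigr => i _.
  by rewrite mulrBl /N mulr_suml.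
apply: le_trans (ler_norm_sum _ _ _) _; apply: le_trans dev.
by apply: ler_sum => i _; rewrite normrM ler_piMr.
Qed.

(** * Sums along a short stretch *)

Lemma cell_quotient (P Q L i c b : nat) :
  (i < P * Q)%N -> in_window (P * Q) L i c -> (b %% P + L.+2 <= P)%N ->
  (b %/ P < Q)%N -> (i <= b)%N ->
  (c + (b - i) = P * (Q * (c %/ (P * Q)) + b %/ P) + (c %% (P * Q) - i) + b %% P)%N /\
  (c %% (P * Q) - i < L)%N.
Proof.
move=> iM win bP bQ ib; have M0 : (0 < P * Q)%N by exact: leq_ltn_trans iM.
have [z hz] := cyc_diffE i c M0; rewrite /in_window in win.
set e := cyc_diff _ _ _ in win hz.
have bE := divn_eq b P; have cE := divn_eq c (P * Q); have cM := ltn_pmod c M0.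
have ieM : (i + e < P * Q)%N.
  by move: bE bP bQ ib win; clear; nia.
have ce : (c %% (P * Q) = i + e)%N.
  move: hz cE cM ieM; move: (c %% _)%N => r; move: (c %/ _)%N => k; move: (P * Q)%N => M.
  clear => hz cE cM ieM.
  have h : (r%:Z - (i + e)%N%:Z = (z - k%:Z) * M%:Z)%R by nia.
  have [z0|[h1|h1]] : (z - k%:Z = 0 \/ z - k%:Z <= -1 \/ 1 <= z - k%:Z)%R by lia.
  - by move: h; rewrite z0 mul0r; lia.
  - by nia.
  - by nia.
rewrite ce addKn; split=> //.
move: bE cE ib; rewrite ce; clear; nia.
Qed.

Lemma tm_prod_cell (R : archiRealFieldType) (P lam L i : nat) (J : seq nat)
    (u : R) (a v : nat -> R) : ~~ odd (size J) -> (0 < P)%N -> 0 <= u ->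
  {in J, forall j, 0 <= a j} ->
  {in J, forall j, u + a j <= v j <= u + a j + P%:R^-1} ->
  (i < P * 2 ^ lam)%N -> in_window (P * 2 ^ lam) L i (Num.truncn (P%:R * u)) ->
  {in J, forall j, let b := (i + Num.truncn (P%:R * a j))%N in
    (b %% P + L.+2 <= P)%N /\ (b %/ P < 2 ^ lam)%N} ->
  tm_prod R J (fun j => Num.truncn (v j)) =
  tm_prod R J (fun j => (i + Num.truncn (P%:R * a j)) %/ P)%N.
Proof.
move=> evJ P0 u0 a0 va iM win good.
set c := Num.truncn (P%:R * u) in win.
pose y := (c %/ (P * 2 ^ lam))%N.
have PR : 0 < P%:R :> R by rewrite ltr0n.
have PR0 := ltW PR.
transitivity (tm_prod R J (fun j => 2 ^ lam * y + (i + Num.truncn (P%:R * a j)) %/ P)%N).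
  apply: eq_big_seq => j jJ; congr (tm_sign _ _).
  have [b1 b2] := good j jJ; set B := Num.truncn _ in b1 b2 *.
  have [cB eL] := cell_quotient iM win b1 b2 (leq_addr _ _).
  rewrite addKn -/y in cB.
  set k := (2 ^ lam * y + (i + B) %/ P)%N in cB *.
  have /andP[c1 c2] := truncn_itv (mulr_ge0 (ltW PR) u0); rewrite -/c in c1 c2.
  have /andP[B1 B2] := truncn_itv (mulr_ge0 (ltW PR) (a0 j jJ)); rewrite -/B in B1 B2.
  have /andP[v1 v2] := va j jJ.
  have k1 : (P * k <= c + B)%N by rewrite cB -addnA leq_addr.
  have k2 : (c + B + 3 <= P * k.+1)%N.
    by move: cB eL b1; clear; nia.
  apply: truncn_def; apply/andP; split.
    rewrite -(ler_pM2l PR); move: k1; rewrite -(ler_nat R) natrM natrD => k1.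
    have := ler_wpM2l (ltW PR) v1; rewrite mulrDr; lra.
  rewrite -(ltr_pM2l PR); move: k2; rewrite -(ler_nat R) natrM !natrD => k2.
  have := ler_wpM2l (ltW PR) v2; rewrite !mulrDr divff ?gt_eqF //.
  move: c2 B2; rewrite -(natr1 c) -(natr1 B); lra.
by rewrite tm_prod_split ?tm_prod_const_even ?mul1r // => j /good[].
Qed.

Lemma sum_cell_tm_prod (R : archiRealFieldType) (T q P Q W : nat)
    (J : seq nat) (al : R) : uniq J -> J != [::] ->
  {in J, forall j, (j < T)%N} -> (T * T.+1 + T < 2 ^ q)%N -> (0 < P)%N ->
  0 <= al ->
  `|\sum_(0 <= i < P * ((2 ^ q.+2) ^ W * Q))
     tm_prod R J (fun j => (i + Num.truncn (P%:R * (j%:R * al))) %/ P)%N| <=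
  (P * ((2 ^ q.+2) ^ W * Q))%:R *
  digit_weight (2 ^ q.+2) T.+1 (1 - 2 / (2 ^ q.+2)%:R) W (Num.truncn al).
Proof.
move=> uJ nJ JT qT P0 al0; set d := Num.truncn al.
have /andP[d1 d2] := truncn_itv al0; rewrite -/d in d1 d2.
have PR : 0 < P%:R :> R by rewrite ltr0n.
have PR0 := ltW PR.
rewrite big_nat_mul_mod (le_trans (ler_norm_sum _ _ _)) // natrM -mulrA.
pose C : R := ((2 ^ q.+2) ^ W * Q)%:R *
  digit_weight (2 ^ q.+2) T.+1 (1 - 2 / (2 ^ q.+2)%:R) W d.
rewrite -/C.
apply: le_trans (_ : \sum_(0 <= r < P) C <= _); last first.
  by rewrite sumr_const_nat subn0 mulr_natl.
rewrite big_nat [leRHS]big_nat; apply: ler_sum => r /andP[_ rP].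
pose e j := ((r + Num.truncn (P%:R * (j%:R * al))) %/ P - j * d)%N.
have eE j : (j * d + e j = (r + Num.truncn (P%:R * (j%:R * al))) %/ P)%N.
  rewrite /e subnKC // leq_divRL //; apply: leq_trans (leq_addl _ _).
  rewrite truncn_ge_nat ?mulr_ge0 // !natrM mulrC ler_wpM2l //.
  by rewrite ler_wpM2l.
have eT : {in J, forall j, (e j <= T)%N}.
  move=> j jJ; rewrite leq_subLR -ltnS ltn_divLR //.
  have : (Num.truncn (P%:R * (j%:R * al)) <= P * (j * d.+1))%N.
    rewrite -(ler_nat R); have := truncn_itv (mulr_ge0 (ltW PR) (mulr_ge0 (ler0n R j) al0)).
    move=> /andP[B1 _]; apply: le_trans B1 _; rewrite !natrM ler_wpM2l //.
    by rewrite ler_wpM2l // ltW.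
  have := JT j jJ; move: (Num.truncn _) => B.
  move: rP; clear; nia.
rewrite (eq_bigr (fun m => tm_prod R J (fun j => m + (j * d + e j))%N)) => [|m _].
  exact: tm_correlation_bound.
apply: eq_bigr => j _; congr (tm_sign _ _).
by rewrite -addnA mulnC divnMDl // eE.
Qed.

Definition bad_cell (R : archiRealFieldType) (P Q L : nat) (J : seq nat) (al : R)
    (i : nat) : bool :=
  has (fun j => let b := (i + Num.truncn (P%:R * (j%:R * al)))%N in
         (P < b %% P + L.+2)%N || (Q <= b %/ P)%N) J.

Lemma count_high_residue (R : numDomainType) (P Q L B : nat) : (L.+1 <= P)%N ->
  \sum_(0 <= i < P * Q) (P < (i + B) %% P + L.+2)%N%:R <= (L.+1 * Q)%:R :> R.
Proof.
move=> LP; have P0 : (0 < P)%N by exact: leq_trans LP.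
rewrite big_nat_mul_mod exchange_big /= natrM mulr_natr.
apply: le_trans (_ : \sum_(0 <= m < Q) L.+1%:R <= _); last by rewrite sumr_const_nat subn0.
apply: ler_sum => m _; have BP := ltn_pmod B P0.
have [a aB] : exists a, (a + B %% P = P.-1)%N.
  by exists (P.-1 - B %% P)%N; rewrite subnK // -ltnS prednK.
have <- : \sum_(0 <= r < P) (in_window P L.+1 r a)%:R * 1 = L.+1%:R :> R.
  by rewrite sum_in_window // sumr_const_nat subn0.
rewrite big_nat [leRHS]big_nat; apply: ler_sum => r /andP[_ rP].
rewrite mulr1 ler_nat -addnA mulnC modnMDl /in_window.
have [z hz] := cyc_diffE r a P0; have dP : (cyc_diff P r a < P)%N by rewrite ltn_pmod.
have [z' hz'] : exists z' : int, (((r + B) %% P)%N%:Z = r%:Z + (B %% P)%N%:Z + z' * P%:Z)%R.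
  exists ((B %/ P)%:Z - ((r + B) %/ P)%:Z).
  by have := divn_eq (r + B) P; have := divn_eq B P; clear; lia.
have r'P := ltn_pmod (r + B) P0; clear m.
move: hz dP hz' BP aB r'P; move: (cyc_diff _ _ _) => D; move: ((r + B) %% P)%N => r'.
move: (B %% P)%N => B'; move: P0 rP LP; clear => P0 rP LP hz dP hz' BP aB r'P.
have h : ((D + r')%N%:Z - P.-1%:Z = (z' - z) * P%:Z)%R by lia.
have [z0|[h1|h1]] : (z' - z = 0 \/ z' - z <= -1 \/ 1 <= z' - z)%R by lia.
- by move: h; rewrite z0 mul0r; case: ltnP => //=; case: ltnP => //=; lia.
- by nia.
- by nia.
Qed.

Lemma count_overflow (R : numDomainType) (M B : nat) :
  \sum_(0 <= i < M) (M <= i + B)%N%:R <= B%:R :> R.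
Proof.
rewrite big_nat_rev /= (eq_big_nat _ _ (F2 := fun i => (i < B)%N%:R)) => [|i iM].
  by rewrite sum_ltn_minn ler_nat geq_minr.
by congr (nat_of_bool _)%:R; lia.
Qed.

Lemma count_bad_cell (R : archiRealFieldType) (P Q L T : nat) (J : seq nat) (al : R) :
  {in J, forall j, (j < T)%N} -> (L.+1 <= P)%N -> (0 < Q)%N -> 0 <= al ->
  \sum_(0 <= i < P * Q) (bad_cell P Q L J al i)%:R <=
  (P * Q)%:R * ((size J)%:R * (L.+1%:R / P%:R + T%:R * al / Q%:R)) :> R.
Proof.
move=> JT LP Q0 al0.
have P0 : (0 < P)%N by exact: leq_trans LP.
have PR : 0 < P%:R :> R by rewrite ltr0n.
have PR0 := ltW PR.
have QR : 0 < Q%:R :> R by rewrite ltr0n.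
pose C : R := (L.+1 * Q)%:R + P%:R * (T%:R * al).
have -> : (P * Q)%:R * ((size J)%:R * (L.+1%:R / P%:R + T%:R * al / Q%:R)) =
    (size J)%:R * C.
  by rewrite /C !natrM; field; rewrite !gt_eqF.
elim: J JT => [|j J IH] JT.
  by rewrite big1 ?mul0r.
have IHJ := IH (fun i iJ => JT i (mem_behead (s := j :: J) iJ)).
apply: le_trans (_ : \sum_(0 <= i < P * Q)
   (((P < (i + Num.truncn (P%:R * (j%:R * al))) %% P + L.+2)%N%:R
   + (P * Q <= i + Num.truncn (P%:R * (j%:R * al)))%N%:R)
   + (bad_cell P Q L J al i)%:R) <= _).
  apply: ler_sum => i _; rewrite /bad_cell /= leq_divRL // mulnC.
  by rewrite -!natrD ler_nat; case: (P < _)%N; case: (P * Q <= _)%N; case: has.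
rewrite !big_split /= -(natr1 (size J)) mulrDl mul1r addrC lerD //.
rewrite /C lerD ?count_high_residue // (le_trans (count_overflow _ _ _)) //.
have jal : 0 <= j%:R * al by rewrite mulr_ge0.
have /andP[B1 _] := truncn_itv (mulr_ge0 (ltW PR) jal).
apply: le_trans B1 _; rewrite ler_wpM2l // ler_wpM2r // ler_nat ltnW // JT //.
by rewrite mem_head.
Qed.

Lemma diff_near_linear (R : realFieldType) (N : nat) (x : nat -> R) (s g : R) :
  0 <= s -> (forall n, (n < N)%N -> s <= diff2 x n <= g) ->
  forall n j, (n + j < N)%N ->
  x n + j%:R * (x 1%N - x 0%N) <= x (n + j)%N
    <= x n + j%:R * (x 1%N - x 0%N) + j%:R * (N%:R * g).
Proof.
move=> s0 x2 n j njN; pose y i := x i.+1 - x i.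
have y1 i : (i.+1 < N)%N -> s <= y i.+1 - y i.
  by move=> /ltnW/x2/andP[].
have y2 i : (i.+1 < N)%N -> y i.+1 - y i <= g.
  by move=> /ltnW/x2/andP[].
have g0 : 0 <= g.
  have /andP[] := x2 n (leq_ltn_trans (leq_addr _ _) njN).
  by move=> h1 h2; exact: le_trans s0 (le_trans h1 h2).
have x1 i : (i.+1 < N)%N -> y 0%N <= x i.+1 - x i.
  move=> /ltnW iN; have := incr_diff_ge y1 (m := 0%N) (k := i) iN.
  have : 0 <= i%:R * s by rewrite mulr_ge0.
  rewrite add0n /y; lra.
have x1' i : (i.+1 < N)%N -> x i.+1 - x i <= y 0%N + N%:R * g.
  move=> /ltnW iN; have := incr_diff_le y2 (m := 0%N) (k := i) iN.
  have : i%:R * g <= N%:R * g by rewrite ler_wpM2r // ler_nat ltnW.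
  rewrite add0n /y; lra.
have := incr_diff_ge x1 njN; have := incr_diff_le x1' njN.
rewrite /y mulrDr => h1 h2; apply/andP; split; lra.
Qed.

(* In the bound, [3 * theta] comes from the deviation from equidistribution and the
   last term from the cells for which the value of [tm_prod] is not determined. *)
Lemma tm_prod_short_sum (R : archiRealFieldType) (T q W lam P L H K : nat)
    (J : seq nat) (x : nat -> R) (s e theta : R) :
  uniq J -> J != [::] -> {in J, forall j, (j < T)%N} -> ~~ odd (size J) ->
  (T * T.+1 + T < 2 ^ q)%N -> (q.+2 * W <= lam)%N ->
  (0 < L)%N -> (2 * L <= P)%N -> (0 < K)%N ->
  0 < s -> 0 <= e <= 1 -> (forall n, 0 <= x n) -> x 0%N <= x 1%N ->
  (forall n, (n < H + T)%N -> s <= diff2 x n <= s * (1 + e)) ->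
  H%:R * (P%:R * s) <= 2 * e ->
  P%:R * (T%:R * ((H + T)%:R * (s * (1 + e)))) <= 1 ->
  2 * K%:R <= e * H%:R / (P * 2 ^ lam)%:R ->
  4 * (P * 2 ^ lam)%:R <= e * H%:R * (P%:R * s) * K%:R ->
  0 <= theta -> L%:R^-1 + 12 * e <= theta ^+ 2 ->
  `|\sum_(0 <= n < H) tm_prod R J (fun j => Num.truncn (x (n + j)%N))| <=
  H%:R * (digit_weight (2 ^ q.+2) T.+1 (1 - 2 / (2 ^ q.+2)%:R) W
            (Num.truncn (x 1%N - x 0%N))
          + 3 * theta
          + 2 * ((size J)%:R * (L.+1%:R / P%:R +
                 T%:R * (x 1%N - x 0%N) / (2 ^ lam)%:R))).
Proof.
move=> uJ nJ JT evJ qT qW L0 LP K0 s0 e01 x0 al0 x2 Hs err KH MK th0 thL.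
set al := x 1%N - x 0%N; have {}al0 : 0 <= al by rewrite subr_ge0.
set Q := (2 ^ lam)%N in KH MK *; set M := (P * Q)%N in KH MK.
have P0 : (0 < P)%N by apply: leq_trans LP; rewrite muln_gt0.
have Q0 : (0 < Q)%N by rewrite expn_gt0.
have M0 : (0 < M)%N by rewrite muln_gt0 P0.
have PR : 0 < P%:R :> R by rewrite ltr0n.
have MR : 0 < M%:R :> R by rewrite ltr0n.
have LR : 0 < L%:R :> R by rewrite ltr0n.
have LP1 : (L.+1 <= P)%N.
  by apply: leq_trans LP; rewrite mul2n -addnn -addn1 leq_add2l.
have LM : (2 * L <= M)%N by rewrite (leq_trans LP) // leq_pmulr.
have LM1 : (L <= M)%N by rewrite (leq_trans _ LM) // leq_pmull.
pose X n := P%:R * x n.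
have X0 n : 0 <= X n by rewrite mulr_ge0 // ltW.
have X2 n : (n < H)%N -> P%:R * s <= diff2 X n <= P%:R * s * (1 + e).
  move=> nH; have /andP[h1 h2] := x2 n (leq_trans nH (leq_addr _ _)).
  have -> : diff2 X n = P%:R * diff2 x n by rewrite /diff2 /X; ring.
  by rewrite -mulrA !ler_pM2l // h1.
pose F i := tm_prod R J (fun j => (i + Num.truncn (P%:R * (j%:R * al))) %/ P)%N.
pose G n := tm_prod R J (fun j => Num.truncn (x (n + j)%N)).
pose E i := bad_cell P Q L J al i.
pose Wi i n := in_window M L i (Num.truncn (X n)).
have Ps0 : 0 < P%:R * s by rewrite mulr_gt0.
have eqd F' := @window_equidistribution R H M K L X (P%:R * s) e theta F'
   M0 K0 L0 LM Ps0 e01 X0 X2 Hs KH MK th0 thL.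
have FG n i : (n < H)%N -> (i < M)%N -> Wi i n ->
    `|G n - F i| <= 2 * (E i)%:R.
  move=> nH iM win; case Ei : (E i).
    rewrite mulr1 (le_trans (ler_normB _ _)) // !normr_tm_prod; lra.
  rewrite mulr0 normr_le0 subr_eq0; apply/eqP.
  apply: (@tm_prod_cell R P lam L i J (x n) (fun j => j%:R * al)) => //.
  - by move=> j _; rewrite mulr_ge0.
  - move=> j jJ; have njN : (n + j < H + T)%N.
      by rewrite -addSn leq_add // ltnW // JT.
    have /andP[h1 h2] := diff_near_linear (ltW s0) x2 njN.
    rewrite h1 /= (le_trans h2) // lerD2l -(ler_pM2l PR) divff ?gt_eqF //.
    apply: le_trans err; rewrite ler_pM2l // ler_wpM2r ?ler_nat 1?ltnW ?JT //.
    have /andP[e0 _] := e01.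
    by rewrite !mulr_ge0 ?addr_ge0 // ltW.
  - move=> j jJ /=; move: Ei; rewrite /E /bad_cell => /hasPn/(_ j jJ).
    by rewrite negb_or -leqNgt -ltnNge => /andP[].
have sW n : \sum_(0 <= i < M) (Wi i n)%:R = L%:R :> R.
  rewrite (eq_bigr (fun i => (Wi i n)%:R * 1)) => [|i _]; last by rewrite mulr1.
  by rewrite sum_in_window // sumr_const_nat subn0.
have LG : L%:R * \sum_(0 <= n < H) G n =
    \sum_(0 <= n < H) \sum_(0 <= i < M) (Wi i n)%:R * F i +
    \sum_(0 <= n < H) \sum_(0 <= i < M) (Wi i n)%:R * (G n - F i).
  rewrite -big_split mulr_sumr; apply: eq_bigr => n _.
  rewrite -big_split /= -(sW n) mulr_suml; apply: eq_bigr => i _; ring.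
pose err2 : R := (size J)%:R * (L.+1%:R / P%:R + T%:R * al / Q%:R).
set wt := digit_weight _ _ _ _ _.
have b1 : `|\sum_(0 <= n < H) \sum_(0 <= i < M) (Wi i n)%:R * F i| <=
    L%:R * H%:R * (wt + theta).
  have h := eqd F (fun i => _); have {}h := h ltac:(by move=> i; rewrite normr_tm_prod).
  have hF : `|\sum_(0 <= i < M) F i| <= M%:R * wt.
    have -> : M = (P * ((2 ^ q.+2) ^ W * 2 ^ (lam - q.+2 * W)))%N.
      by rewrite -expnM -expnD subnKC.
    exact: sum_cell_tm_prod.
  have h3 : `|L%:R * H%:R / M%:R * \sum_(0 <= i < M) F i| <= L%:R * H%:R * wt.
    rewrite normrM ger0_norm ?divr_ge0 ?mulr_ge0 //.
    rewrite -[leLHS]mulrA ler_wpM2l ?mulr_ge0 //.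
    by rewrite mulrC ler_pdivrMr // mulrC.
  have h4 := le_trans (lerB_dist _ _) h.
  rewrite mulrDr addrC; move: h4; rewrite lerBlDr => /le_trans; apply.
  by rewrite lerD2l.
have b2 : `|\sum_(0 <= n < H) \sum_(0 <= i < M) (Wi i n)%:R * (G n - F i)| <=
    2 * (L%:R * H%:R * (err2 + theta)).
  apply: le_trans (_ : 2 * \sum_(0 <= n < H) \sum_(0 <= i < M) (Wi i n)%:R * (E i)%:R <= _).
    rewrite mulr_sumr (le_trans (ler_norm_sum _ _ _)) //.
    rewrite big_nat [leRHS]big_nat; apply: ler_sum => n /andP[_ nH].
    rewrite mulr_sumr (le_trans (ler_norm_sum _ _ _)) //.
    rewrite big_nat [leRHS]big_nat; apply: ler_sum => i /andP[_ iM].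
    case wi : (Wi i n); last by rewrite !mul0r mulr0 normr0.
    by rewrite !mul1r FG.
  rewrite ler_pM2l //.
  have E1 i : `|(E i)%:R : R| <= 1 by rewrite normr_nat (ler_nat _ _ 1); case: (E i).
  have h := eqd (fun i => (E i)%:R) E1.
  have hE : \sum_(0 <= i < M) (E i)%:R <= M%:R * err2 by exact: count_bad_cell.
  have h3 : L%:R * H%:R / M%:R * \sum_(0 <= i < M) (E i)%:R <= L%:R * H%:R * err2.
    rewrite -[leLHS]mulrA ler_wpM2l ?mulr_ge0 //.
    by rewrite mulrC ler_pdivrMr // mulrC.
  have := le_trans (ler_norm _) h; rewrite mulrDr -/Wi.
  rewrite lerBlDr => /le_trans; apply.
  by rewrite addrC lerD.
have := le_trans (ler_normD _ _) (lerD b1 b2); rewrite -LG normrM (ger0_norm (ltW LR)).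
move=> bnd; rewrite -(ler_pM2l LR); apply: le_trans bnd _.
by rewrite -/err2 le_eqVlt; apply/orP; left; apply/eqP; ring.
Qed.

Lemma nat_above (R : archiRealFieldType) (r : R) : exists2 n : nat, (0 < n)%N & r <= n%:R.
Proof.
exists (Num.truncn r).+1 => //; exact: ltW (truncnS_gt r).
Qed.

Lemma tm_prod_short_sum_uniform (R : archiRealFieldType) (T q W : nat)
    (J : seq nat) (eta : R) :
  uniq J -> J != [::] -> {in J, forall j, (j < T)%N} -> ~~ odd (size J) ->
  (T * T.+1 + T < 2 ^ q)%N -> 0 < eta ->
  exists delta e kappa : R,
  [/\ 0 < delta <= 1, 0 < e <= 1, 0 < kappa & forall (H : nat) (x : nat -> R) (s : R),
    0 < s -> s <= kappa -> delta / 2 <= H%:R * s <= delta ->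
    (forall n, 0 <= x n) -> x 0%N <= x 1%N ->
    (forall n, (n < H + T)%N -> s <= diff2 x n <= s * (1 + e)) ->
    (x 1%N - x 0%N + 1) ^+ 2 * s <= kappa ->
    `|\sum_(0 <= n < H) tm_prod R J (fun j => Num.truncn (x (n + j)%N))| <=
    H%:R * (digit_weight (2 ^ q.+2) T.+1 (1 - 2 / (2 ^ q.+2)%:R) W
            (Num.truncn (x 1%N - x 0%N)) + eta)].
Proof.
move=> uJ nJ JT evJ qT eta0.
pose theta := eta / 6; have th0 : 0 < theta by rewrite divr_gt0.
have th20 : 0 < theta ^+ 2 by rewrite exprn_gt0.
have [L L0 Lth] := nat_above (2 / theta ^+ 2).
have LR : 0 < L%:R :> R by rewrite ltr0n.
pose e := Num.min 1 (theta ^+ 2 / 24).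
have e0 : 0 < e by rewrite /e lt_min ltr01 divr_gt0.
have e1 : e <= 1 by rewrite /e ge_min lexx.
have eth : L%:R^-1 + 12 * e <= theta ^+ 2.
  have h1 : e <= theta ^+ 2 / 24 by rewrite /e ge_min lexx orbT.
  have h2 : L%:R^-1 <= theta ^+ 2 / 2.
    by rewrite -[leRHS]invrK lef_pV2 ?posrE ?invr_gt0 ?divr_gt0 // invf_div.
  lra.
have thE : theta = eta / 6 by [].
clearbody e theta.
have sJ : 0 <= (size J)%:R :> R by [].
have [P1 P10 P1b] := nat_above (8 * (size J)%:R * L.+1%:R / eta).
pose P := (P1 + 2 * L)%N.
have P0 : (0 < P)%N by rewrite addn_gt0 P10.
have PR : 0 < P%:R :> R by rewrite ltr0n.
have PJ : 2 * ((size J)%:R * (L.+1%:R / P%:R)) <= eta / 4.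
  have : 8 * (size J)%:R * L.+1%:R / eta <= P%:R.
    by apply: le_trans P1b _; rewrite ler_nat leq_addr.
  rewrite ler_pdivrMr // => h.
  have : 8 * ((size J)%:R * (L.+1%:R / P%:R)) <= eta.
    by rewrite !mulrA ler_pdivrMr // [leRHS]mulrC.
  lra.
have T0 : (0 < T)%N by case: (J) nJ JT => // j J' _ /(_ j (mem_head _ _)); case: (T).
have TR : 0 < T%:R :> R by rewrite ltr0n.
pose delta := Num.min 1 (Num.min (2 * e / P%:R) ((4 * P%:R * T%:R)^-1)).
have d0 : 0 < delta.
  by rewrite /delta !lt_min ltr01 divr_gt0 ?mulr_gt0 //= invr_gt0 !mulr_gt0.
have d1 : delta <= 1 by rewrite /delta ge_min lexx.
have dP : P%:R * delta <= 2 * e.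
  by rewrite mulrC -ler_pdivlMr // /delta !ge_min lexx !orbT.
have dT : 4 * (P%:R * (T%:R * delta)) <= 1.
  rewrite !mulrA mulrC -ler_pdivlMr ?mulr_gt0 // div1r.
  by rewrite /delta !ge_min lexx !orbT.
clearbody delta.
have [C0 C00 C0b] := nat_above (8 * (size J)%:R * T%:R / eta).
pose C := (C0 + 2 ^ (q.+2 * W))%N.
have C_0 : (0 < C)%N by rewrite addn_gt0 C00.
have CR : 0 < C%:R :> R by rewrite ltr0n.
have CJ : 2 * ((size J)%:R * T%:R) <= C%:R * (eta / 4).
  have : 8 * (size J)%:R * T%:R / eta <= C%:R.
    by apply: le_trans C0b _; rewrite ler_nat leq_addr.
  rewrite ler_pdivrMr //; lra.
pose k1 := e ^+ 2 * delta ^+ 2 / (256 * P%:R * C%:R ^+ 2).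
have k10 : 0 < k1.
  have h1 : 0 < 256 * P%:R * C%:R ^+ 2 :> R.
    by apply: mulr_gt0; [apply: mulr_gt0; rewrite ?ltr0n|rewrite exprn_gt0].
  by apply: divr_gt0 h1; apply: mulr_gt0; rewrite exprn_gt0.
pose kappa := Num.min k1 (Num.min (delta / T%:R) 1).
have kappa0 : 0 < kappa by rewrite /kappa !lt_min k10 ltr01 divr_gt0.
have kk1 : kappa <= k1 by rewrite /kappa ge_min lexx.
have kkT : kappa <= delta / T%:R by rewrite /kappa !ge_min lexx orbT.
clearbody kappa.
exists delta, e, kappa; split; rewrite ?d0 ?e0 //.
move=> H x s s0 sk /andP[Hs1 Hs2] x0 x01 x2 als.
have HR : 0 < H%:R :> R by rewrite -(pmulr_lgt0 _ s0) (lt_le_trans _ Hs1) // divr_gt0.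
have H0 : (0 < H)%N by rewrite -(ltr_nat R).
set al := x 1%N - x 0%N in als *.
have al0 : 0 <= al by rewrite subr_ge0.
have al10 : 0 <= al + 1 by exact: addr_ge0 al0 ler01.
pose N := (C * (Num.truncn al).+1)%N.
have N0 : (0 < N)%N by rewrite muln_gt0 C_0.
pose lam := (trunc_log 2 N).+1.
have Q1 : (N < 2 ^ lam)%N by rewrite trunc_log_ltn.
have Q2 : (2 ^ lam <= 2 * N)%N by rewrite /lam expnS leq_mul2l /= trunc_logP.
have qW : (q.+2 * W <= lam)%N.
  rewrite -(@leq_exp2l 2) //; apply: leq_trans (ltnW Q1).
  by rewrite /N mulnS (leq_trans _ (leq_addr _ _)) // leq_addl.
set Q := (2 ^ lam)%N in Q1 Q2.
have QR : 0 < Q%:R :> R by rewrite ltr0n expn_gt0.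
have alN : al * C%:R <= Q%:R.
  apply: le_trans (_ : N%:R <= _); last by rewrite ler_nat ltnW.
  by rewrite /N natrM mulrC ler_wpM2l // ltW // truncnS_gt.
have Qal : Q%:R <= 2 * C%:R * (al + 1).
  apply: le_trans (_ : (2 * N)%:R <= _); first by rewrite ler_nat.
  rewrite /N !natrM -mulrA ler_wpM2l // ler_wpM2l // -natr1 lerD2r.
  by have /andP[] := truncn_itv al0.
have [M ME] : exists M, M = (P * Q)%N by exists (P * Q)%N.
have MPQ : M%:R = P%:R * Q%:R :> R by rewrite ME natrM.
have MR : 0 < M%:R :> R by rewrite MPQ mulr_gt0.
have M2 : 64 * M%:R ^+ 2 * s <= e ^+ 2 * delta ^+ 2 * P%:R.
  have h1 : (al + 1) ^+ 2 * s <= k1 by exact: le_trans als kk1.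
  have h2 : Q%:R ^+ 2 <= (2 * C%:R * (al + 1)) ^+ 2.
    have h0 : 0 <= 2 * C%:R * (al + 1) by rewrite mulr_ge0 // mulr_ge0.
    apply: lerXn2r; rewrite ?nnegrE //; exact: ltW.
  have h3 : 64 * M%:R ^+ 2 * s <= 256 * P%:R ^+ 2 * C%:R ^+ 2 * ((al + 1) ^+ 2 * s).
    rewrite MPQ.
    have : 64 * P%:R ^+ 2 * s * Q%:R ^+ 2 <= 64 * P%:R ^+ 2 * s * (2 * C%:R * (al + 1)) ^+ 2.
      by rewrite ler_wpM2l // !mulr_ge0 ?exprn_ge0 // ltW.
    move=> h; apply: le_trans (_ : 64 * P%:R ^+ 2 * s * Q%:R ^+ 2 <= _).
      by rewrite le_eqVlt; apply/orP; left; apply/eqP; ring.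
    by apply: le_trans h _; rewrite le_eqVlt; apply/orP; left; apply/eqP; ring.
  apply: le_trans h3 _; apply: le_trans (_ : 256 * P%:R ^+ 2 * C%:R ^+ 2 * k1 <= _).
    by rewrite ler_wpM2l // !mulr_ge0 ?exprn_ge0.
  by rewrite le_eqVlt; apply/orP; left; apply/eqP; rewrite /k1; field; rewrite !gt_eqF.
have PHs : H%:R * (P%:R * s) <= 2 * e.
  apply: le_trans dP; rewrite mulrCA ler_wpM2l //; exact: ltW.
have Hs0 : 0 < H%:R * s by rewrite mulr_gt0.
have KM1 : 16 * M%:R ^+ 2 <= e ^+ 2 * H%:R ^+ 2 * (P%:R * s).
  have h : (delta / 2) ^+ 2 <= (H%:R * s) ^+ 2.
    by rewrite ler_pXn2r ?nnegrE // ltW // divr_gt0.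
  have h' : e ^+ 2 * P%:R * (delta / 2) ^+ 2 <= e ^+ 2 * P%:R * (H%:R * s) ^+ 2.
    by rewrite ler_wpM2l // mulr_ge0 ?exprn_ge0 // ltW.
  rewrite -(ler_pM2r s0).
  apply: le_trans (_ : e ^+ 2 * P%:R * (H%:R * s) ^+ 2 <= _); last first.
    by rewrite le_eqVlt; apply/orP; left; apply/eqP; ring.
  by apply: le_trans h'; move: M2; lra.
have eH2M : 1 <= e * H%:R / (2 * M%:R).
  rewrite ler_pdivlMr ?mulr_gt0 // mul1r.
  have e0' := ltW e0; rewrite -(@ler_pXn2r _ 2) ?nnegrE ?mulr_ge0 //.
  have Ps2 : P%:R * s <= 2.
    apply: le_trans (_ : H%:R * (P%:R * s) <= _); last by lra.
    by rewrite ler_peMl ?ler1n // mulr_ge0 // ltW.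
  have : e ^+ 2 * H%:R ^+ 2 * (P%:R * s) <= e ^+ 2 * H%:R ^+ 2 * 2.
    by rewrite ler_wpM2l // mulr_ge0 ?exprn_ge0 // ltW.
  have : 0 <= e ^+ 2 * H%:R ^+ 2 by rewrite mulr_ge0 ?exprn_ge0 // ltW.
  rewrite (_ : (2 * M%:R) ^+ 2 = 4 * M%:R ^+ 2); last by ring.
  rewrite (_ : (e * H%:R) ^+ 2 = e ^+ 2 * H%:R ^+ 2); last by ring.
  move: KM1; clear => KM1 h1 h2; lra.
pose K := Num.truncn (e * H%:R / (2 * M%:R)).
have K0 : (0 < K)%N by rewrite truncn_gt0.
have /andP[Ka Kb] : K%:R <= e * H%:R / (2 * M%:R) < K.+1%:R.
  by rewrite truncn_itv // (le_trans ler01).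
have K2 : e * H%:R / (4 * M%:R) <= K%:R.
  have : 1 <= K%:R :> R by rewrite ler1n.
  move: Kb; rewrite -natr1.
  have -> : e * H%:R / (2 * M%:R) = 2 * (e * H%:R / (4 * M%:R)).
    by field; rewrite gt_eqF.
  lra.
have := @tm_prod_short_sum R T q W lam P L H K J x s e theta uJ nJ JT evJ qT qW L0.
rewrite -/al -/Q -ME => main.
apply: le_trans (main _ K0 s0 _ x0 x01 x2 PHs _ _ _ (ltW th0) eth) _.
- by rewrite leq_addl.
- by rewrite ltW.
- have hT : (H + T)%:R * s <= 2 * delta.
    have : s <= delta / T%:R by exact: le_trans sk kkT.
    rewrite ler_pdivlMr // natrD mulrDl => hh; lra.
  have h1 : (H + T)%:R * (s * (1 + e)) <= 4 * delta.
    rewrite mulrA; have : 0 <= (H + T)%:R * s by rewrite mulr_ge0 // ltW.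
    move: hT e1 e0; clear; nra.
  apply: le_trans dT.
  rewrite (_ : 4 * _ = P%:R * (T%:R * (4 * delta))); last by ring.
  by rewrite !ler_wpM2l.
- move: Ka; rewrite ler_pdivlMr ?mulr_gt0 // => Ka.
  rewrite ler_pdivlMr //; lra.
- have h : e * H%:R * (P%:R * s) * (e * H%:R / (4 * M%:R)) <= e * H%:R * (P%:R * s) * K%:R.
    by rewrite ler_wpM2l // !mulr_ge0 // ltW.
  apply: le_trans h.
  have -> : e * H%:R * (P%:R * s) * (e * H%:R / (4 * M%:R)) =
     e ^+ 2 * H%:R ^+ 2 * (P%:R * s) / (4 * M%:R) by field; rewrite gt_eqF.
  rewrite ler_pdivlMr ?mulr_gt0 //; lra.
rewrite ler_wpM2l //.
have lastb : 2 * ((size J)%:R * (T%:R * al / Q%:R)) <= eta / 4.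
  rewrite !mulrA ler_pdivrMr //.
  apply: le_trans (_ : C%:R * (eta / 4) * al <= _).
    by rewrite -(mulrA 2) ler_wpM2r.
  have : eta / 4 * (al * C%:R) <= eta / 4 * Q%:R by rewrite ler_wpM2l // ltW // divr_gt0.
  lra.
rewrite -addrA lerD2l mulrDr mulrDr; move: PJ lastb; rewrite thE; lra.
Qed.

(** * Slowly convex sequences *)

(* The second difference is almost constant, equal to [s], along [C / s]
   consecutive terms, and this length is [o(n)] by the last clause. *)
Definition slowly_convex (R : realType) (x : nat -> R) : Prop :=
  [/\ forall n, 0 <= x n, forall n, x n <= x n.+1 &
  forall C eps : R, 0 < eps -> exists N : nat, forall n, (N <= n)%N ->
    exists s : R, [/\ 0 < s,
      forall k, k%:R * s <= C -> s <= diff2 x (n + k) <= s * (1 + eps),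
      (x n.+1 - x n + 1) ^+ 2 * s <= eps & 1 <= eps * n%:R * s]].

Lemma exists_expr_le (R : realType) (r eps : R) : 0 <= r < 1 -> 0 < eps ->
  exists W : nat, r ^+ W <= eps.
Proof.
move=> /andP[r0 r1] eps0; have r1' : `|r| < 1 by rewrite ger0_norm.
have /cvgrPdist_le/(_ eps eps0)[N _ h] := cvg_expr r1'.
exists N; have := h N (leqnn N); rewrite /= sub0r normrN.
by rewrite ger0_norm // exprn_ge0.
Qed.

Lemma sum_weight_equidistributed (R : archiRealFieldType) (G D : nat)
    (al : nat -> R) (w : nat -> R) (delta : R) :
  (0 < D)%N -> 0 < delta <= 1 -> (forall d, 0 <= w d) ->
  (forall d, w (d %% D)%N = w d) -> (forall i, 0 <= al i) ->
  (forall i, (i.+1 < G)%N -> delta / 2 <= al i.+1 - al i <= 2 * delta) ->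
  D%:R / delta <= G%:R <= D%:R / delta + 1 ->
  \sum_(0 <= i < G) w (Num.truncn (al i)) <=
  18 * G%:R * ((\sum_(0 <= d < D) w d) / D%:R).
Proof.
move=> D0 /andP[d0 d1] w0 wD al0 ali /andP[G1 G2].
have DR : 0 < D%:R :> R by rewrite ltr0n.
have DR1 : 1 <= D%:R :> R by rewrite ler1n.
have -> : \sum_(0 <= i < G) w (Num.truncn (al i)) = \sum_(0 <= d < D)
    w d * \sum_(0 <= i < G) (Num.truncn (al i) %% D == d)%N%:R.
  under [RHS]eq_bigr do rewrite mulr_sumr.
  rewrite exchange_big /=; apply: eq_bigr => i _.
  have mD : (Num.truncn (al i) %% D < D)%N by rewrite ltn_mod.
  rewrite big_mkord (bigD1 (Ordinal mD)) //= eqxx mulr1 wD big1 ?addr0 // => d.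
  by rewrite -val_eqE /= eq_sym => /negbTE ->; rewrite mulr0.
have cnt d : (d < D)%N ->
    \sum_(0 <= i < G) (Num.truncn (al i) %% D == d)%N%:R <= 18 / delta.
  move=> dD.
  have := @count_separated_mod R G al (fun i => Num.truncn (al i) %% D == d)%N
    (delta / 2) (2 * delta) d%:R 1 D%:R.
  move=> h; apply: le_trans (h _ _ DR _ ali _) _ => {h}.
  - by rewrite divr_gt0.
  - by rewrite mulr_ge0 // ltW.
  - by rewrite ler01.
  - move=> i _ /eqP md; exists (Num.truncn (al i) %/ D)%N.
    have /andP[a1 a2] := truncn_itv (al0 i).
    have tE : (Num.truncn (al i))%:R = d%:R + (Num.truncn (al i) %/ D)%N%:R * D%:R :> R.
      by rewrite -natrM -natrD addnC {1}(divn_eq (Num.truncn (al i)) D) md.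
    rewrite -pmulrn -tE a1 /=; move: a2; rewrite -natr1; lra.
  have h1 : G%:R * (2 * delta) / D%:R + 2 <= 6.
    have : G%:R * (2 * delta) <= 4 * D%:R.
      have : G%:R * delta <= (D%:R / delta + 1) * delta by rewrite ler_wpM2r // ltW.
      rewrite mulrDl divfK ?gt_eqF //; lra.
    by rewrite -ler_pdivrMr // => h; lra.
  have h2 : 1 / (delta / 2) + 1 <= 3 / delta.
    have -> : 1 / (delta / 2) + 1 = (2 + delta) / delta by field; rewrite gt_eqF.
    by rewrite ler_pM2r ?invr_gt0 //; lra.
  have h20 : 0 <= 1 / (delta / 2) + 1 :> R.
    by rewrite addr_ge0 // divr_ge0 // divr_ge0 // ltW.
  apply: le_trans (_ : 6 * (3 / delta) <= _); last first.
    by rewrite le_eqVlt; apply/orP; left; apply/eqP; ring.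
  apply: le_trans (ler_wpM2r h20 h1) _.
  by rewrite ler_wpM2l.
apply: le_trans (_ : \sum_(0 <= d < D) w d * (18 / delta) <= _).
  rewrite big_nat [leRHS]big_nat; apply: ler_sum => d /andP[_ dD].
  by rewrite ler_wpM2l // cnt.
rewrite -mulr_suml; set S := \sum_(0 <= d < D) w d.
have S0 : 0 <= S by apply: sumr_ge0.
have : 18 * (S / D%:R) * (D%:R / delta) <= 18 * (S / D%:R) * G%:R.
  by rewrite ler_wpM2l // mulr_ge0 // divr_ge0 // ltW.
move=> h; apply: le_trans (_ : 18 * (S / D%:R) * (D%:R / delta) <= _).
  by rewrite le_eqVlt; apply/orP; left; apply/eqP; field; rewrite !gt_eqF.
by apply: le_trans h _; rewrite le_eqVlt; apply/orP; left; apply/eqP; ring.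
Qed.

Lemma tm_prod_block_sum (R : realType) (T : nat) (J : seq nat) (x : nat -> R)
    (eta : R) :
  uniq J -> J != [::] -> {in J, forall j, (j < T)%N} -> ~~ odd (size J) ->
  slowly_convex x -> 0 < eta ->
  exists N : nat, forall n, (N <= n)%N -> exists len : nat,
    [/\ (0 < len)%N, len%:R <= eta * n%:R &
     `|\sum_(0 <= k < len) tm_prod R J (fun j => Num.truncn (x (n + k + j)%N))|
       <= eta * len%:R].
Proof.
move=> uJ nJ JT evJ [x0 x1 xs] eta0.
pose q := (T * T.+1 + T)%N; have qT : (T * T.+1 + T < 2 ^ q)%N by exact: ltn_expl.
pose U := (2 ^ q.+2)%N.
have U4 : (4 <= U)%N by rewrite /U !expnS mulnA -[leqLHS]muln1 leq_mul2l expn_gt0.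
have U0 : (0 < U)%N by exact: leq_trans U4.
have UR : 4 <= U%:R :> R by rewrite ler_nat.
have UR0 : 0 < U%:R :> R by lra.
have U2R : 0 < U%:R ^+ 2 :> R by rewrite exprn_gt0.
pose rho : R := 1 - 2 / U%:R ^+ 2.
have rho01 : 0 <= rho < 1.
  rewrite /rho subr_ge0 ler_pdivrMr // mul1r ltrBlDr ltrDl divr_gt0 // andbT.
  by rewrite expr2; move: UR; clear; nra.
have k0 : 0 <= 1 - 2 / U%:R :> R.
  by rewrite subr_ge0 ler_pdivrMr // mul1r; move: UR; clear; lra.
have [W rW] := exists_expr_le rho01 (divr_gt0 (divr_gt0 eta0 (ltr0Sn R 1)) (ltr0Sn R 17)).
have [delta [e [kappa [d01 /andP[e0 e1] kappa0 short]]]] :=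
  tm_prod_short_sum_uniform W uJ nJ JT evJ qT (divr_gt0 eta0 (ltr0Sn R 1)).
have /andP[d0 d1] := d01.
pose D := (U ^ W)%N; have D0 : (0 < D)%N by rewrite expn_gt0 U0.
have DR : 0 < D%:R :> R by rewrite ltr0n.
pose G := (Num.truncn (D%:R / delta)).+1.
have Dd : 0 <= D%:R / delta by rewrite divr_ge0 // ltW.
have G12 : D%:R / delta <= G%:R <= D%:R / delta + 1.
  rewrite ltW ?truncnS_gt //= /G -natr1 lerD2r.
  by have /andP[] := truncn_itv Dd.
have GR : 1 <= G%:R :> R by rewrite ler1n.
have GR0 : 0 < G%:R :> R by rewrite ltr0n.
clearbody G.
pose b := (1 + 2 * G%:R : R); have b1 : 1 <= b by rewrite /b; move: GR; clear; lra.
have b20 : 0 < b ^+ 2 by rewrite exprn_gt0 // (lt_le_trans ltr01).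
pose eps := Num.min e (Num.min (kappa / b ^+ 2) (Num.min (delta / 2) (eta / G%:R))).
have eps0 : 0 < eps by rewrite /eps !lt_min e0 !divr_gt0.
have ee : eps <= e by rewrite /eps ge_min lexx.
have ek : eps * b ^+ 2 <= kappa.
  by rewrite -ler_pdivlMr // /eps !ge_min lexx !orbT.
have ed : eps <= delta / 2 by rewrite /eps !ge_min lexx !orbT.
have eG : G%:R * eps <= eta.
  by rewrite mulrC -ler_pdivlMr // /eps !ge_min lexx !orbT.
clearbody eps.
have [N hN] := xs (G%:R + 1 + T%:R) eps eps0.
exists N => n nN; have [s [s0 sx als ns]] := hN n nN.
have al0 m : 0 <= x m.+1 - x m by rewrite subr_ge0.
have se : s <= eps.
  have s0' := ltW s0; apply: le_trans als; rewrite ler_peMl //.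
  by rewrite exprn_ege1 // lerDr.
have s1 : s <= 1.
  by move: se ed d1; clear; lra.
pose H := Num.truncn (delta / s).
have ds0 : 0 <= delta / s by rewrite divr_ge0 // ltW.
have /andP[H1 H2] := truncn_itv ds0; rewrite -/H in H1 H2.
have Hs : delta / 2 <= H%:R * s <= delta.
  move: H1 H2; rewrite ler_pdivlMr // ltr_pdivrMr // -natr1 mulrDl mul1r.
  by move: se ed; clear => *; apply/andP; split; lra.
have /andP[Hs1 Hs2] := Hs.
have H0 : (0 < H)%N.
  rewrite -(ltr_nat R) -(pmulr_lgt0 _ s0) (lt_le_trans _ Hs1) // divr_gt0 //.
clearbody H.
have sxe i k : (i < G)%N -> (k < H + T)%N -> s <= diff2 x (n + (H * i + k))%N <= s * (1 + e).
  move=> iG kH; have : (H * i + k)%:R * s <= G%:R + 1 + T%:R.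
    apply: le_trans (_ : (H * G + T)%:R * s <= _).
      rewrite ler_wpM2r ?(ltW s0) // ler_nat; move: iG kH; clear; nia.
    rewrite natrD natrM mulrDl.
    have h1 : H%:R * G%:R * s <= G%:R.
      by rewrite mulrAC ler_piMl // (le_trans Hs2).
    have h2 : T%:R * s <= T%:R by rewrite ler_piMr.
    by move: h1 h2; clear; lra.
  move=> /sx/andP[-> h] /=; apply: le_trans h _.
  by rewrite ler_pM2l // lerD2l.
pose al i := x (n + H * i).+1 - x (n + H * i)%N.
have alinc i : (i.+1 < G)%N -> delta / 2 <= al i.+1 - al i <= 2 * delta.
  move=> /ltnW iG; pose y k := x (n + (H * i + k)).+1 - x (n + (H * i + k))%N.
  have yi k : (k.+1 < H.+1)%N -> s <= y k.+1 - y k <= s * (1 + e).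
    rewrite ltnS => kH; have := sxe i k iG (leq_trans kH (leq_addr _ _)).
    by rewrite /diff2 /y !addnS.
  have y1 k : (k.+1 < H.+1)%N -> s <= y k.+1 - y k by move=> /yi/andP[].
  have y2 k : (k.+1 < H.+1)%N -> y k.+1 - y k <= s * (1 + e) by move=> /yi/andP[].
  have h1 := incr_diff_ge y1 (m := 0%N) (k := H) (ltnSn H).
  have h2 := incr_diff_le y2 (m := 0%N) (k := H) (ltnSn H).
  have yE0 : y 0%N = al i by rewrite /y /al addn0.
  have yEH : y H = al i.+1 by rewrite /y /al mulnSr.
  rewrite add0n yE0 yEH in h1 h2.
  move: h1 h2 Hs1 Hs2 e0 e1 d0; clear => h1 h2 Hs1 Hs2 e0 e1 d0.
  have h3 : H%:R * (s * (1 + e)) <= 2 * delta by rewrite mulrA; nra.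
  by apply/andP; split; lra.
have alle i : (i < G)%N -> al i <= al 0%N + 2 * G%:R.
  move=> iG; have y2 k : (k.+1 < G)%N -> al k.+1 - al k <= 2 * delta by move=> /alinc/andP[].
  have := incr_diff_le y2 (m := 0%N) (k := i) iG; rewrite add0n.
  have : i%:R * (2 * delta) <= 2 * G%:R.
    rewrite mulrCA ler_pM2l // (le_trans (_ : _ <= i%:R)) ?ler_piMr //.
    by rewrite ler_nat ltnW.
  by clear; lra.
have al00 i : 0 <= al i by exact: al0.
have b_al i : (i < G)%N -> (al i + 1) ^+ 2 * s <= kappa.
  move=> iG; have h0 : al 0%N = x n.+1 - x n by rewrite /al muln0 addn0.
  have h1 : al i + 1 <= b * (al 0%N + 1).
    have := alle i iG; have := al00 0%N; rewrite /b; move: GR; clear; nra.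
  have h2 : (al i + 1) ^+ 2 <= (b * (al 0%N + 1)) ^+ 2.
    have z1 : 0 <= al i + 1 by exact: addr_ge0.
    by apply: lerXn2r; rewrite ?nnegrE // (le_trans z1).
  apply: le_trans (ler_wpM2r (ltW s0) h2) _.
  rewrite exprMn -mulrA h0; apply: le_trans ek; rewrite [leRHS]mulrC.
  by rewrite ler_wpM2l // ltW.
exists (H * G)%N; split.
- by rewrite muln_gt0 H0 -(ltr_nat R).
- rewrite natrM -(ler_pM2r s0) mulrAC.
  apply: le_trans (_ : G%:R <= _); first by rewrite ler_piMl // (le_trans Hs2).
  have : G%:R * 1 <= G%:R * (eps * n%:R * s) by rewrite ler_pM2l.
  rewrite mulr1 => /le_trans; apply; rewrite !mulrA.
  by rewrite ler_wpM2r ?(ltW s0) // ler_wpM2r.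
rewrite big_nat_mul_mod exchange_big /=.
have piece i : (i < G)%N ->
    `|\sum_(0 <= k < H) tm_prod R J (fun j => Num.truncn (x (n + (H * i + k) + j)%N))|
    <= H%:R * (digit_weight U T.+1 (1 - 2 / U%:R) W (Num.truncn (al i)) + eta / 2).
  move=> iG; pose z k := x (n + (H * i + k))%N.
  have z10 : z 1%N - z 0%N = al i by rewrite /z /al addn0 addn1 addnS.
  have dz k : (k < H + T)%N -> s <= diff2 z k <= s * (1 + e).
    by move=> kH; have := sxe i k iG kH; rewrite /diff2 /z !addnS.
  have := short H z s s0 _ Hs (fun k => x0 _) _ dz.
  rewrite z10 => h.
  rewrite (eq_bigr (fun k => tm_prod R J (fun j => Num.truncn (z (k + j)%N))))
    => [|k _]; last first.
    by apply: eq_bigr => j _; rewrite /z !addnA.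
  apply: h.
  - apply: le_trans se (le_trans _ ek); have eps0' := ltW eps0.
    by rewrite ler_peMr // exprn_ege1.
  - by rewrite -subr_ge0 z10.
  - exact: b_al.
apply: le_trans (ler_norm_sum _ _ _) _.
apply: le_trans (_ : \sum_(0 <= i < G)
  H%:R * (digit_weight U T.+1 (1 - 2 / U%:R) W (Num.truncn (al i)) + eta / 2) <= _).
  by rewrite big_nat [leRHS]big_nat; apply: ler_sum => i /andP[_ iG]; exact: piece.
rewrite -mulr_sumr big_split /= sumr_const_nat subn0 -[_ *+ G]mulr_natl natrM.
rewrite [leRHS]mulrC -mulrA ler_wpM2l //.
have TU : (T.+1 < U)%N.
  have : (2 ^ q <= U)%N by rewrite leq_exp2l // -addn2 leq_addr.
  by move: qT U4; clear; nia.
have wt := @sum_weight_equidistributed R G D al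
  (digit_weight U T.+1 (1 - 2 / U%:R) W) delta D0 d01
  (fun d => digit_weight_ge0 _ _ _ _ k0) (fun d => digit_weight_mod _ _ _ _ _)
  al00 alinc G12.
rewrite sum_digit_weight // in wt.
have rE : U.-1%:R + (1 - 2 / U%:R) = U%:R * rho.
  by rewrite -subn1 natrB // /rho; field; rewrite gt_eqF.
have rDE : (U%:R * rho) ^+ W / D%:R = rho ^+ W.
  by rewrite exprMn /D natrX mulrAC divff ?mul1r // expf_neq0 // gt_eqF.
rewrite rE rDE in wt.
have : 18 * G%:R * rho ^+ W <= 18 * G%:R * (eta / 2 / 18) by rewrite ler_wpM2l // mulr_ge0.
by move: wt; clear; lra.
Qed.

(** * Vanishing means *)

Lemma norm_sum_le_card (R : numDomainType) (n : nat) (f : nat -> R) :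
  (forall k, `|f k| <= 1) -> `|\sum_(0 <= k < n) f k| <= n%:R.
Proof.
move=> f1; apply: le_trans (ler_norm_sum _ _ _) _.
apply: le_trans (ler_sum _ (fun k _ => f1 k)) _.
by rewrite sumr_const_nat subn0.
Qed.

Definition vanishing_mean (R : numDomainType) (f : nat -> R) : Prop :=
  forall eta : R, 0 < eta -> exists N : nat, forall n, (N <= n)%N ->
    `|\sum_(0 <= k < n) f k| <= eta * n%:R.

Lemma vanishing_mean0 (R : realFieldType) : vanishing_mean (fun=> 0 : R).
Proof.
move=> eta eta0; exists 0%N => n _.
by rewrite big1 // normr0 mulr_ge0 // ltW.
Qed.

Lemma vanishing_meanD (R : realFieldType) (f g : nat -> R) :
  vanishing_mean f -> vanishing_mean g -> vanishing_mean (fun n => f n + g n).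
Proof.
move=> vf vg eta eta0; have e2 : 0 < eta / 2 by rewrite divr_gt0.
have [N hN] := vf _ e2; have [M hM] := vg _ e2.
exists (maxn N M) => n; rewrite geq_max => /andP[/hN h1 /hM h2].
rewrite big_split /= (le_trans (ler_normD _ _)) //; lra.
Qed.

Lemma vanishing_meanZ (R : realFieldType) (c : R) (f : nat -> R) :
  vanishing_mean f -> vanishing_mean (fun n => c * f n).
Proof.
move=> vf eta eta0; have c0 : 0 < `|c| + 1 by rewrite ltr_pwDr.
have [N hN] := vf (eta / (`|c| + 1)) (divr_gt0 eta0 c0).
exists N => n /hN h; rewrite -mulr_sumr normrM.
apply: le_trans (_ : (`|c| + 1) * (eta / (`|c| + 1) * n%:R) <= _).
  by rewrite ler_pM // lerDl.
by rewrite mulrA mulrC [X in _ * X]mulrC divfK ?gt_eqF // mulrC.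
Qed.

Lemma vanishing_mean_sum (R : realFieldType) (I : Type) (s : seq I) (P : pred I)
    (f : I -> nat -> R) : (forall i, P i -> vanishing_mean (f i)) ->
  vanishing_mean (fun n => \sum_(i <- s | P i) f i n).
Proof.
move=> vf; elim: s => [|i s IH].
  under eq_fun do rewrite big_nil; exact: vanishing_mean0.
under eq_fun do rewrite big_cons.
by have [Pi|Pi] := boolP (P i); first exact: vanishing_meanD (vf i Pi) IH.
Qed.

Lemma vanishing_mean_tiling (R : archiRealFieldType) (f : nat -> R) :
  (forall n, `|f n| <= 1) ->
  (forall eta : R, 0 < eta -> exists N : nat, forall n, (N <= n)%N ->
     exists len : nat, [/\ (0 < len)%N, len%:R <= eta * n%:R &
       `|\sum_(0 <= k < len) f (n + k)%N| <= eta * len%:R]) ->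
  vanishing_mean f.
Proof.
move=> f1 tile eta eta0; have e3 : 0 < eta / 3 by rewrite divr_gt0.
have [N hN] := tile _ e3.
have nrm m len := norm_sum_le_card len (fun k => f1 (m + k)%N).
have cut m len := big_nat_addn m len f.
have claim n : (N <= n)%N -> exists m len : nat,
    [/\ (m <= n)%N, (n < m + len)%N, len%:R <= eta / 3 * m%:R,
      `|\sum_(0 <= k < len) f (m + k)%N| <= eta / 3 * len%:R &
      `|\sum_(0 <= k < m) f k| <= N%:R + eta / 3 * m%:R].
  elim: n => [|n IH].
    rewrite leqn0 => /eqP N0; have [len [l0 l1 l2]] := hN 0%N (eq_leq N0).
    exists 0%N, len; split=> //.
    by rewrite big_geq // normr0 mulr0 addr0.
  rewrite leq_eqVlt => /orP[/eqP Nn|].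
    have [len [l0 l1 l2]] := hN n.+1 (eq_leq Nn).
    exists n.+1, len; split=> //; first by rewrite -[X in (X < _)%N]addn0 ltn_add2l.
    rewrite Nn; apply: le_trans (_ : n.+1%:R <= _).
      by have := nrm 0%N n.+1.
    by rewrite lerDl mulr_ge0 // ltW.
  rewrite ltnS => /[dup] Nn /IH[m [len [mn nm l1 l2 l3]]].
  have [h|h] := ltnP n.+1 (m + len).
    by exists m, len; split=> //; exact: leqW.
  have E : (m + len = n.+1)%N by apply/eqP; rewrite eqn_leq h nm.
  have [len' [k0 k1 k2]] := hN n.+1 (leqW Nn).
  exists n.+1, len'; split=> //; first by rewrite -[X in (X < _)%N]addn0 ltn_add2l.
  rewrite -E cut (le_trans (ler_normD _ _)) // natrD mulrDr addrA.
  exact: lerD.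
have [M M0 hM] := nat_above (N%:R / (eta / 3)).
exists (maxn N M) => n; rewrite geq_max => /andP[Nn Mn].
have [m [len [mn nm l1 l2 l3]]] := claim n Nn.
have -> : n = (m + (n - m))%N by rewrite subnKC.
rewrite cut (le_trans (ler_normD _ _)) //.
apply: le_trans (lerD l3 (nrm _ _)) _; rewrite subnKC //.
have h1 : (n - m)%:R <= len%:R :> R by rewrite ler_nat leq_subLR ltnW.
have h2 : eta / 3 * m%:R <= eta / 3 * n%:R by rewrite ler_pM2l // ler_nat.
have h3 : N%:R <= eta / 3 * n%:R.
  rewrite mulrC -ler_pdivrMr //; apply: le_trans hM _; by rewrite ler_nat.
by move: h1 h2 h3 l1; clear; lra.
Qed.

Lemma vanishing_mean_vdC (R : archiRealFieldType) (T : nat) (f : nat -> R) :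
  (forall n, `|f n| <= 1) ->
  (forall r r', (r < r')%N -> vanishing_mean (fun n => f (n + r * T)%N * f (n + r' * T)%N)) ->
  vanishing_mean f.
Proof.
move=> f1 corr eta eta0.
have [S S0 hS] := nat_above (8 / eta ^+ 2).
have SR : 0 < S%:R :> R by rewrite ltr0n.
have vr r r' : r' != r -> vanishing_mean (fun n => f (n + r * T)%N * f (n + r' * T)%N).
  rewrite neq_ltn => /orP[/corr h|/corr//] e /h[N hN]; exists N => n /hN.
  by under [in X in _ -> X]eq_bigr do rewrite mulrC.
pose off n := \sum_(r <- index_iota 0 S) \sum_(r' <- index_iota 0 S | r' != r)
  f (n + r * T)%N * f (n + r' * T)%N.
have voff : vanishing_mean off.
  by apply: vanishing_mean_sum => r _; apply: vanishing_mean_sum => r'; exact: vr.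
have [N hN] := voff _ SR.
have [M M0 hM] := nat_above (4 * (S * T)%:R / eta).
exists (maxn N M) => n; rewrite geq_max => /andP[/hN {}hN Mn].
have nrm m len := norm_sum_le_card len (fun k => f1 (m + k)%N).
have cut m len := big_nat_addn m len f.
pose A := \sum_(0 <= k < n) f k; rewrite -/A.
pose V k := \sum_(0 <= r < S) f (k + r * T)%N.
have shift h : `|A - \sum_(0 <= k < n) f (k + h)%N| <= 2 * h%:R.
  have -> : \sum_(0 <= k < n) f (k + h)%N = \sum_(0 <= k < n) f (h + k)%N.
    by apply: eq_bigr => k _; rewrite addnC.
  have E := cut h n; rewrite addnC cut -/A in E.
  have -> : A - \sum_(0 <= k < n) f (h + k)%N =
    \sum_(0 <= k < h) f k - \sum_(0 <= k < h) f (n + k)%N.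
    by move: E; clear; lra.
  apply: le_trans (ler_normB _ _) _.
  have := nrm 0%N h; have := nrm n h; clear => h1 h2; apply: le_trans (lerD h2 h1) _; lra.
have AV : `|S%:R * A - \sum_(0 <= k < n) V k| <= S%:R * (2 * (S * T)%:R).
  rewrite exchange_big /= [S%:R * A](_ : _ = \sum_(0 <= r < S) A); last first.
    by rewrite sumr_const_nat subn0 mulr_natl.
  rewrite -sumrB (le_trans (ler_norm_sum _ _ _)) //.
  apply: le_trans (_ : \sum_(0 <= r < S) 2 * (S * T)%:R <= _); last first.
    by rewrite sumr_const_nat subn0 -[leLHS]mulr_natl.
  rewrite big_nat [leRHS]big_nat; apply: ler_sum => r /andP[_ rS].
  by rewrite (le_trans (shift _)) // ler_pM2l // ler_nat leq_mul2r ltnW ?orbT.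
have V2 : \sum_(0 <= k < n) V k ^+ 2 <= 2 * S%:R * n%:R.
  have Vk k : V k ^+ 2 <= S%:R + off k.
    have -> : V k ^+ 2 = \sum_(0 <= r < S) f (k + r * T)%N ^+ 2 + off k.
      rewrite expr2 /V mulr_suml -big_split /=; apply: eq_big_seq => r rS.
      rewrite mulr_sumr (bigD1_seq r) ?iota_uniq //.
    rewrite lerD2r; apply: le_trans (_ : \sum_(0 <= r < S) (1 : R) <= _).
      apply: ler_sum => r _; rewrite -real_normK ?num_real // exprn_ile1 //.
    by rewrite sumr_const_nat subn0.
  apply: le_trans (ler_sum _ (fun k _ => Vk k)) _.
  rewrite big_split /= sumr_const_nat subn0 -[_ *+ n]mulr_natr.
  have := le_trans (ler_norm _) hN; clear; lra.
have V1 : `|\sum_(0 <= k < n) V k| <= S%:R * (eta / 2) * n%:R.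
  have z : 0 <= S%:R * (eta / 2) * n%:R.
    by apply: mulr_ge0 => //; apply: mulr_ge0 => //; rewrite divr_ge0 // ltW.
  rewrite -(@ler_pXn2r _ 2) ?nnegrE //.
  apply: le_trans (_ : (\sum_(0 <= k < n) `|V k|) ^+ 2 <= _).
    by rewrite lerXn2r ?nnegrE ?sumr_ge0 // ler_norm_sum.
  apply: le_trans (sqr_sum_norm_le _ _) _.
  apply: le_trans (ler_wpM2l (ler0n _ _) V2) _.
  have h : 2 * S%:R <= S%:R ^+ 2 * (eta / 2) ^+ 2.
    move: hS; rewrite ler_pdivrMr ?exprn_gt0 // => hS.
    have : S%:R * 8 <= S%:R * (S%:R * eta ^+ 2) by rewrite ler_pM2l.
    by clear; lra.
  have := ler_wpM2r (exprn_ge0 2 (ler0n R n)) h; clear; lra.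
have hM' : 2 * (S * T)%:R <= eta / 2 * n%:R.
  have : 4 * (S * T)%:R / eta <= n%:R by apply: le_trans hM _; rewrite ler_nat.
  by rewrite ler_pdivrMr //; clear; lra.
have := ler_normD (S%:R * A - \sum_(0 <= k < n) V k) (\sum_(0 <= k < n) V k).
rewrite subrK normrM (ger0_norm (ltW SR)) => h.
rewrite -(ler_pM2l SR); apply: le_trans h _; apply: le_trans (lerD AV V1) _.
have := ler_wpM2l (ltW SR) hM'; clear; lra.
Qed.

Lemma tm_prod_vanishing_mean (R : realType) (J : seq nat) (x : nat -> R) :
  uniq J -> J != [::] -> slowly_convex x ->
  vanishing_mean (fun n => tm_prod R J (fun j => Num.truncn (x (n + j)%N))).
Proof.
move=> uJ nJ sx.
have [jm jmJ jmax] := seq_has_max nJ; pose T := jm.+1.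
have JT : {in J, forall j, (j < T)%N} by move=> j /jmax; rewrite ltnS.
apply: (@vanishing_mean_vdC _ T) => [n|r r' rr']; first by rewrite normr_tm_prod.
pose J' := [seq (r * T + j)%N | j <- J] ++ [seq (r' * T + j)%N | j <- J].
have E n : tm_prod R J (fun j => Num.truncn (x (n + r * T + j)%N)) *
    tm_prod R J (fun j => Num.truncn (x (n + r' * T + j)%N)) =
    tm_prod R J' (fun j => Num.truncn (x (n + j)%N)).
  rewrite /tm_prod /J' big_cat !big_map; congr (_ * _);
    by apply: eq_bigr => j _; rewrite addnA.
have uJ' : uniq J'.
  rewrite cat_uniq !map_inj_uniq ?uJ //; try by move=> a b /addnI.
  rewrite /= andbT; apply/hasPn => _ /mapP[j jJ ->]; apply/mapP => -[i iJ].
  have iT := JT i iJ; have : (r.+1 * T <= r' * T)%N by rewrite leq_mul2r rr' orbT.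
  rewrite mulSn; move: iT; clear; lia.
have nJ' : J' != [::] by rewrite /J'; case: (J) nJ.
have JT' : {in J', forall j, (j < r.+1 * T + r'.+1 * T)%N}.
  move=> _ /[!mem_cat]/orP[] /mapP[j /JT jT ->].
    by rewrite mulSn; move: jT; clear; lia.
  by rewrite mulSn; move: jT; clear; lia.
under eq_fun do rewrite E.
apply: vanishing_mean_tiling => [n|eta eta0]; first by rewrite normr_tm_prod.
apply: (tm_prod_block_sum uJ' nJ' JT') => //.
by rewrite /J' size_cat !size_map addnn odd_double.
Qed.

(** * Normality *)

Lemma tm_indicator_expansion (R : realFieldType) (T : nat) (v : nat -> nat)
    (eps : 'I_T -> 'I_2) :
  ([forall j : 'I_T, thue_morse (v j) == eps j])%:R =
  2 ^- T * \sum_(A : {set 'I_T}) (\prod_(j in A) (-1) ^+ (eps j)) *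
     tm_prod R [seq val j | j <- enum A] v :> R.
Proof.
have fac (j : 'I_T) : (thue_morse (v j) == eps j)%N%:R =
    2^-1 * ((-1) ^+ (eps j) * tm_sign R (v j) + 1) :> R.
  rewrite /tm_sign; have : (thue_morse (v j) < 2)%N by rewrite ltn_mod.
  case: (thue_morse _) => [|[|]] //; case: (eps j) => -[|[|]] //= _ _;
    rewrite ?expr0 ?expr1; lra.
transitivity (\prod_(j : 'I_T) ((thue_morse (v j) == eps j)%N%:R : R)).
  have [/forallP h|] := boolP [forall j : 'I_T, thue_morse (v j) == eps j].
    by rewrite big1 // => j _; rewrite h.
  rewrite negb_forall => /existsP[j nj].
  by rewrite (bigD1 j) //= (negbTE nj) mul0r.
rewrite (eq_bigr _ (fun j _ => fac j)) big_split /= prodr_const card_ord exprVn.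
congr (_ * _); rewrite bigA_distr; apply: eq_bigr => A _.
rewrite -big_mkcond big_split /=; congr (_ * _).
by rewrite /tm_prod big_map big_enum.
Qed.

Lemma block_count_cvg (R : realType) (T : nat) (v : nat -> nat)
    (eps : 'I_T -> 'I_2) :
  (forall J, uniq J -> J != [::] ->
     vanishing_mean (fun n => tm_prod R J (fun j => v (n + j)%N))) ->
  (fun N : nat => (block_count (fun n => thue_morse (v n)) eps N)%:R / N%:R : R) @ \oo
    --> (2 ^- T : R).
Proof.
move=> vJ.
pose f n : R := ([forall j : 'I_T, thue_morse (v (n + j)%N) == eps j])%:R.
have vf : vanishing_mean (fun n => f n - 2 ^- T).
  have E n : f n - 2 ^- T = \sum_(A : {set 'I_T} | A != finset.set0)
     (2 ^- T * \prod_(j in A) (-1) ^+ (eps j)) *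
     tm_prod R [seq val j | j <- enum A] (fun j => v (n + j)%N).
    rewrite /f (tm_indicator_expansion R (fun j => v (n + j)%N)).
    rewrite (bigD1 finset.set0) //= finset.big_set0 finset.enum_set0.
    rewrite /tm_prod big_nil mulr1 mulrDr mulr1 addrC addKr mulr_sumr.
    by apply: eq_bigr => A _; exact: mulrA.
  under eq_fun do rewrite E.
  apply: vanishing_mean_sum => A A0; apply: vanishing_meanZ; apply: vJ.
    by rewrite map_inj_uniq ?enum_uniq //; exact: val_inj.
  by rewrite -size_eq0 size_map -cardE finset.cards_eq0.
apply/cvgrPdist_le => e e0.
have [N hN] := vf (e / 3) (divr_gt0 e0 (ltr0Sn _ 2)).
have [M M0 hM] := nat_above (1 / (e / 3)).
exists (maxn N M) => //= n /=; rewrite geq_max => /andP[Nn Mn].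
have n0 : (0 < n)%N by exact: leq_trans Mn.
have nR : 0 < n%:R :> R by rewrite ltr0n.
have -> : (block_count (fun n => thue_morse (v n)) eps n)%:R =
    \sum_(0 <= k < n.+1) f k - f 0%N.
  rewrite /block_count [in RHS]big_ltn // addrAC subrr add0r.
  rewrite -sum1_count natr_sum big_mkcond /=; apply: eq_bigr => k _.
  by rewrite /f; case: [forall j, _].
have := hN n.+1 (leqW Nn).
rewrite sumrB sumr_const_nat subn0 -[_ *+ n.+1]mulr_natl.
set S := \sum_(0 <= k < n.+1) f k; set p := 2 ^- T => hS.
have p01 : 0 <= p <= 1.
  by rewrite /p invr_ge0 exprn_ge0 //= invf_le1 ?exprn_gt0 // exprn_ege1 // ler1n.
have f01 : 0 <= f 0%N <= 1 by rewrite /f; case: [forall j, _]; rewrite lexx ler01.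
have M3 : 1 <= e / 3 * n%:R.
  have : 1 / (e / 3) <= n%:R by apply: le_trans hM _; rewrite ler_nat.
  by rewrite ler_pdivrMr ?divr_gt0 // mulrC.
have -> : p - (S - f 0%N) / n%:R = (p * n%:R - (S - f 0%N)) / n%:R.
  by field; rewrite gt_eqF.
rewrite normrM [`|_^-1|]ger0_norm ?invr_ge0 // ler_pdivrMr //.
have n1 : 1 <= n%:R :> R by rewrite ler1n.
move: hS; rewrite -natr1 !ler_norml => /andP[h1 h2].
move: p01 f01 => /andP[p0 p1] /andP[f0 f1].
move: h1 h2 p0 p1 f0 f1 M3 e0 n1; clear => *.
by apply/andP; split; nra.
Qed.

(** * Powers *)

Lemma powR_is_derive (R : realType) (p x : R) : 0 < x ->
  is_derive x 1 (fun y : R => y `^ p) (p * x `^ (p - 1)).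
Proof.
move=> x0; have xi : x \in `]0, +oo[ by rewrite in_itv /= andbT.
apply: DeriveDef; first exact: derivable_powR.
by rewrite -derive1E powR_derive1.
Qed.

Lemma powR_MVT (R : realType) (p a b : R) : 0 < a -> a < b ->
  exists2 z, a < z < b & b `^ p - a `^ p = p * z `^ (p - 1) * (b - a).
Proof.
move=> a0 ab.
have [||z] := @MVT R (fun y => y `^ p) (fun y => p * y `^ (p - 1)) a b ab.
- by move=> x; rewrite in_itv /= => /andP[ax _]; apply: powR_is_derive; exact: lt_trans ax.
- apply: derivable_within_continuous => x; rewrite in_itv /= => /andP[ax _].
  by apply: derivable_powR; rewrite in_itv /= andbT (lt_le_trans a0).
by rewrite in_itv /=; exists z.
Qed.

Lemma powR_diff2 (R : realType) (p : R) (m : nat) : (0 < m)%N ->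
  exists2 z, m%:R < z < m%:R + 2 &
    diff2 (fun n : nat => n%:R `^ p) m = p * (p - 1) * z `^ (p - 1 - 1).
Proof.
move=> m0; have mR : 0 < m%:R :> R by rewrite ltr0n.
pose g (y : R) := (y + 1) `^ p - y `^ p.
pose dg (y : R) := p * (y + 1) `^ (p - 1) - p * y `^ (p - 1).
have gd (y : R) : 0 < y -> is_derive y 1 g (dg y).
  move=> y0; have y1 : 0 < y + 1 by rewrite addr_gt0.
  apply: is_deriveB; last exact: powR_is_derive.
  have h1 : is_derive y 1 (fun y : R => y + 1) (1 + 0).
    exact: is_deriveD.
  have := @is_derive1_comp R (fun z => z `^ p) (fun y : R => y + 1) y _ _
    (powR_is_derive p y1) h1.
  by rewrite addr0 mulr1.
have m1 : m%:R < m%:R + 1 :> R by rewrite ltrDl.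
have [||y] := @MVT R g dg m%:R (m%:R + 1) m1.
- by move=> x; rewrite in_itv /= => /andP[mx _]; apply: gd; exact: lt_trans mx.
- apply: derivable_within_continuous => x; rewrite in_itv /= => /andP[mx _].
  by case: (gd x (lt_le_trans mR mx)).
rewrite in_itv /= => /andP[my ym] E.
have y0 : 0 < y by exact: lt_trans my.
have y1 : y < y + 1 by rewrite ltrDl.
have [z /andP[yz zy] E2] := powR_MVT (p - 1) y0 y1.
exists z.
  by rewrite (lt_trans my yz) /= (lt_le_trans zy) //; move: ym; clear; lra.
have q1 (u : R) : u + 1 - u = 1 by rewrite addrC addKr.
by move: E; rewrite /diff2 /g /dg -!natr1 -mulrBr E2 !q1 !mulr1 mulrA.
Qed.

Lemma natr_powR_unbounded (R : realType) (p B : R) : 0 < p ->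
  exists N : nat, forall n, (N <= n)%N -> B <= n%:R `^ p.
Proof.
move=> p0; have [N N0 hN] := nat_above (Num.max 0 B `^ p^-1).
exists N => n Nn; apply: le_trans (_ : Num.max 0 B <= _).
  by rewrite le_max lexx orbT.
have -> : Num.max 0 B = (Num.max 0 B `^ p^-1) `^ p.
  by rewrite -powRrM mulVf ?gt_eqF // powRr1 // le_max lexx.
apply: ge0_ler_powR; rewrite ?nnegrE ?powR_ge0 //; first exact: ltW.
by apply: le_trans hN _; rewrite ler_nat.
Qed.

Lemma powR_slowly_convex (R : realType) (c : R) : 1 < c -> c < 4 / 3 ->
  slowly_convex (fun n : nat => n%:R `^ c).
Proof.
move=> c1 c43; split=> [n|n|C eps eps0]; first exact: powR_ge0.
  by apply: ge0_ler_powR; rewrite ?nnegrE // ?ler_nat //; lra.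
have c0 : 0 < c by lra.
have c10 : 0 < c - 1 by lra.
have cc : 0 < c * (c - 1) by rewrite mulr_gt0.
pose e := Num.min 1 eps.
have e0 : 0 < e by rewrite /e lt_min ltr01.
have ee : e <= eps by rewrite /e ge_min lexx orbT.
have e1 : e <= 1 by rewrite /e ge_min lexx.
clearbody e.
pose la := 1 + e; have la1 : 1 <= la by rewrite /la lerDl ltW.
have la0 : 0 < la by rewrite /la addr_gt0.
pose a := c * (c - 1) * la `^ (c - 2).
have a0 : 0 < a by rewrite mulr_gt0 // powR_gt0.
have ac : a <= c * (c - 1).
  have cc' := ltW cc; rewrite /a ler_piMr // -[leRHS](powRr0 la); apply: ler_powR => //; lra.
pose K := c * 2 `^ (c - 1) + 1.
have K0 : 0 < K by rewrite /K addr_gt0 // mulr_gt0 // powR_gt0.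
have [N1 h1] := natr_powR_unbounded (1 / (eps * a) + 2 * `|C| / (e * a)) c10.
have c43' : 0 < 4 - 3 * c by lra.
have [N2 h2] := natr_powR_unbounded (K ^+ 2 * (c * (c - 1)) / eps) c43'.
have [N3 N30 h3] := nat_above (4 / e).
exists (maxn N1 (maxn N2 N3)) => n; rewrite !geq_max => /andP[/h1 {}h1 /andP[/h2 {}h2 nN3]].
have n0 : (0 < n)%N by exact: leq_trans nN3.
have nR : 0 < n%:R :> R by rewrite ltr0n.
have nN0 : n%:R != 0 :> R by rewrite gt_eqF.
have n1 : 1 <= n%:R :> R by rewrite ler1n.
have {}h3 : 4 <= e * n%:R.
  rewrite -ler_pdivrMl // mulrC (le_trans h3) // ler_nat //.
pose s := a * n%:R `^ (c - 2).
have s0 : 0 < s by rewrite mulr_gt0 // powR_gt0.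
have ns : n%:R * s = a * n%:R `^ (c - 1).
  rewrite /s mulrCA; congr (_ * _).
  by rewrite -{1}(powRr1 (ltW nR)) -powRD; [congr (_ `^ _); ring|rewrite nN0 implybT].
exists s; split => //.
- move=> k ksC; have nk0 : (0 < n + k)%N by rewrite addn_gt0 n0.
  have [z /andP[z1 z2] ->] := powR_diff2 c nk0.
  have c2 : c - 1 - 1 = - (2 - c) by ring.
  have c2' : c - 2 = - (2 - c) by ring.
  have z0 : 0 < z by apply: lt_trans z1; rewrite ltr0n.
  have nz : n%:R <= z.
    by apply: le_trans (ltW z1); rewrite ler_nat leq_addr.
  have kn : k%:R <= e * n%:R / 2.
    have : C <= e / 2 * (n%:R * s).
      apply: le_trans (ler_norm C) _; rewrite ns.
      have : 2 * `|C| / (e * a) <= n%:R `^ (c - 1).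
        apply: le_trans h1; rewrite lerDr divr_ge0 // mulr_ge0 // ltW //.
      rewrite ler_pdivrMr; last by apply: mulr_gt0.
      by clear; lra.
    move=> /(le_trans ksC) h; rewrite -(ler_pM2r s0); move: h; clear; lra.
  have zla : z <= la * n%:R.
    move: z2 kn h3; rewrite /la natrD; clear; lra.
  have c2n : 0 <= 2 - c by lra.
  have p1 : z `^ (2 - c) <= (la * n%:R) `^ (2 - c).
    have z0' := ltW z0; have la0' := ltW la0.
    by apply: ge0_ler_powR; rewrite ?nnegrE ?mulr_ge0.
  have p2 : n%:R `^ (2 - c) <= z `^ (2 - c).
    by apply: ge0_ler_powR; rewrite ?nnegrE //; exact: ltW.
  rewrite c2; apply/andP; split.
    have la0' := ltW la0; rewrite /s /a -mulrA ler_pM2l // -powRM // c2' !powRN.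
    by rewrite lef_pV2 ?posrE ?powR_gt0 // mulr_gt0.
  have lae : la `^ (2 - c) <= 1 + eps.
    apply: le_trans (_ : la <= _); last by rewrite lerD2l.
    by apply: ler1_powR => //; lra.
  apply: le_trans (_ : c * (c - 1) * n%:R `^ (- (2 - c)) <= _).
    by rewrite ler_pM2l // !powRN lef_pV2 ?posrE ?powR_gt0.
  have -> : c * (c - 1) * n%:R `^ (- (2 - c)) = s * la `^ (2 - c).
    rewrite /s /a c2' !powRN; field.
    by rewrite !gt_eqF ?powR_gt0.
  by rewrite ler_pM2l.
- have nn1 : n%:R < n%:R + 1 :> R by rewrite ltrDl.
  have [z /andP[z1 z2] E] := powR_MVT c nR nn1.
  rewrite -natr1 E.
  have -> : n%:R + 1 - n%:R = 1 :> R by ring.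
  rewrite mulr1.
  have zp : z `^ (c - 1) <= 2 `^ (c - 1) * n%:R `^ (c - 1).
    rewrite -powRM //; apply: ge0_ler_powR; rewrite ?nnegrE ?mulr_ge0 //; first exact: ltW.
      by rewrite ltW // (lt_trans nR).
    by move: z2 n1; clear; lra.
  have np1 : 1 <= n%:R `^ (c - 1).
    by rewrite -[leLHS](powRr0 n%:R); apply: ler_powR => //; exact: ltW.
  have b1 : c * z `^ (c - 1) + 1 <= K * n%:R `^ (c - 1).
    rewrite /K mulrDl mul1r lerD // -mulrA ler_pM2l //.
  have b0 : 0 <= c * z `^ (c - 1) + 1.
    by rewrite addr_ge0 // mulr_ge0 ?powR_ge0 // ltW.
  have b2 : (c * z `^ (c - 1) + 1) ^+ 2 <= (K * n%:R `^ (c - 1)) ^+ 2.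
    by apply: lerXn2r; rewrite ?nnegrE // (le_trans b0).
  apply: le_trans (ler_wpM2r (ltW s0) b2) _.
  have -> : (K * n%:R `^ (c - 1)) ^+ 2 * s = K ^+ 2 * a * n%:R `^ (- (4 - 3 * c)).
    have -> : - (4 - 3 * c) = (c - 1) + (c - 1) + (c - 2) by ring.
    have pD u v : n%:R `^ (u + v) = n%:R `^ u * n%:R `^ v :> R.
      by rewrite powRD // nN0 implybT.
    rewrite (pD (c - 1 + (c - 1)) (c - 2)) (pD (c - 1) (c - 1)) /s; ring.
  rewrite powRN ler_pdivrMr ?powR_gt0 //.
  apply: le_trans (_ : K ^+ 2 * (c * (c - 1)) <= _).
    by rewrite ler_pM2l // exprn_gt0.
  by move: h2; rewrite ler_pdivrMr // [eps * _]mulrC.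
- have : 1 / (eps * a) <= n%:R `^ (c - 1).
    apply: le_trans h1; rewrite lerDl; apply: divr_ge0; first exact: mulr_ge0.
    by apply: mulr_ge0; exact: ltW.
  rewrite ler_pdivrMr; last by apply: mulr_gt0.
  by rewrite -mulrA ns; clear; lra.
Qed.

Theorem theorem1 (R : realType) (c : R) (hc1 : 1 < c) (hc2 : c < 4 / 3) :
  binary_normal R (thue_morse_power c).
Proof.
move=> T T0 eps.
apply: (@block_count_cvg R T (fun n => Num.truncn (n%:R `^ c))) => J uJ nJ.
exact: (tm_prod_vanishing_mean uJ nJ (powR_slowly_convex hc1 hc2)).
Qed.
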